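(* Let $0<p\le1$ and suppose that $\eta\colon[1,\infty)\to[1,\infty)$ is a concave increasing function. Then the space $\mathcal T^{(p)}$ has a conditional (i.e. not unconditional) almost greedy basis $\mathcal X$ such that - $\boldsymbol k_m[\mathcal X,\mathcal T^{(p)}]\approx \eta^{1/p}(\log m)$ for $m\ge2$, and - the fundamental function of $\mathcal X$ satisfies $\boldsymbol\varphi[\mathcal X,\mathcal T^{(p)}](m)\approx m^{1/p}$ for $m\in\mathbb N$.
   Context: $\mathbb N=\{1,2,\dots\}$; scalars are $\mathbb F=\mathbb R$ or $\mathbb C$. $a_m\approx b_m$ means $c\,b_m\le a_m\le C\,b_m$ with constants $0<c\le C<\infty$ independent of $m$. $\eta^{1/p}(\log m)$ means $(\eta(\log m))^{1/p}$, with $\log$ taken in base 2. Tsirelson's space $\mathcal T$ is the completion of $c_{00}$ (finitely supported scalar sequences indexed by $\mathbb N$) under the unique norm satisfying $\|x\|=\max\{\|x\|_\infty,\ \tfrac12\sup\sum_{i=1}^k\|E_ix\|\}$, the supremum being over all $k\in\mathbb N$ and all finite nonempty $E_1<\dots<E_k$ in $\mathbb N$ with $k\le\min E_1$ ($E_i<E_{i+1}$ means $\max E_i<\min E_{i+1}$; $Ex$ is the restriction of $x$ to $E$). The unit vectors form a normalized $1$-unconditional basis of $\mathcal T$, so $\mathcal T$ is regarded as a space of sequences. For $0<p<\infty$, $\mathcal T^{(p)}$ is the space of scalar sequences $f=(a_n)_{n=1}^\infty$ with $|f|^p=(|a_n|^p)_{n=1}^\infty\in\mathcal T$, with quasi-norm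 $\|f\|=\||f|^p\|_{\mathcal T}^{1/p}$. A basis of a (quasi-)Banach space $X$ is a norm-bounded sequence $\mathcal X=(x_n)_{n=1}^\infty$ with dense linear span for which there is a norm-bounded sequence $(x_n^* )_{n=1}^\infty$ in $X^*$ biorthogonal to it. Given $f\in X$, let $\rho\colon\mathbb N\to\mathbb N$ be the greedy ordering of $f$: the injective map with $\{n: x_n^*(f)\ne0\}\subseteq\rho(\mathbb N)$ such that for $j<k$ either $|x^*_{\rho(j)}(f)|>|x^*_{\rho(k)}(f)|$, or these are equal and $\rho(j)<\rho(k)$. Put $\mathcal G_m(f)=\sum_{j=1}^m x^*_{\rho(j)}(f)x_{\rho(j)}$. The basis is almost greedy if there is $C\ge1$ with $\|f-\mathcal G_m(f)\|\le C\inf\{\|f-\sum_{n\in A}x_n^*(f)x_n\|: |A|=m\}$ for all $f\in X$, $m\in\mathbb N$. The fundamental function is $\boldsymbol\varphi[\mathcal X,X](m)=\sup_{|A|\le m}\|\sum_{n\in A}x_n\|$. For finite $A\subseteq\mathbb N$, $S_A(f)=\sum_{n\in A}x_n^*(f)x_n$, and $\boldsymbol k_m[\mathcal X,X]=\sup_{|A|\le m}\|S_A\|$.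
   Formalization: Conditionality of the basis is asserted only for unbounded η: if η is bounded (e.g. η(t)=2−1/t), the estimate for k_m makes the S_A uniformly bounded and hence the basis unconditional; all other claims are kept for every η. *)

(* Defs.v *)
From HB Require Import structures.
From mathcomp Require Import all_boot all_order all_algebra finmap.
From mathcomp Require Import all_classical all_reals all_analysis.
From mathcomp Require Import complex.

Set Implicit Arguments.
Unset Strict Implicit.
Unset Printing Implicit Defensive.

Import Order.TTheory GRing.Theory Num.Theory.
Import numFieldNormedType.Exports.

Local Open Scope classical_set_scope.
Local Open Scope ring_scope.

(* In MathComp the norm of a complex number is again a complex number, so the
   scalar field carries its real-valued modulus and the embedding of the reals
   explicitly.  Only the two values below are used. *)
Record scalar_field (R : realType) := ScalarField {
  scalar :> numFieldType;
  of_real : R -> scalar;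
  modulus : scalar -> R }.

Definition real_scalars (R : realType) : scalar_field R :=
  @ScalarField R R id (fun x => `|x|).

Definition complex_scalars (R : realType) : scalar_field R :=
  @ScalarField R R[i] (fun x => x%:C%C) (@ComplexField.Normc.normc R).

(* Sequences are indexed by nat: the index n stands for the positive integer
   n.+1. *)
Definition sequences (R : realType) (F : scalar_field R) : lmodType F :=
  nat -> (F : numFieldType)^o.

Definition coord_restriction (R : realType) (F : scalar_field R) (E : {fset nat})
    (x : sequences F) : sequences F :=
  fun n => if n \in E then x n else 0.

Definition c00 (R : realType) (F : scalar_field R) : set (sequences F) :=
  [set x | finite_set [set n | x n != 0]].

Definition fset_lt (A B : {fset nat}) : bool :=
  all (fun a => all (fun b => (a < b)%N) B) A.

(* The last clause is k <= min E_1, where the index n stands for n.+1. *)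
Definition admissible (E : seq {fset nat}) : Prop :=
  [/\ E != [::], fset0 \notin E, sorted fset_lt E &
      forall n, n \in head fset0 E -> (size E <= n.+1)%N].

Definition norm_on_c00 (R : realType) (F : scalar_field R)
    (N : sequences F -> R) : Prop :=
  [/\ forall x, c00 x -> 0 <= N x,
      forall x, c00 x -> N x = 0 -> x = 0,
      forall (a : F) x, c00 x -> N (a *: x) = modulus a * N x &
      forall x y, c00 x -> c00 y -> N (x + y) <= N x + N y].

Definition tsirelson_equation (R : realType) (F : scalar_field R)
    (N : sequences F -> R) : Prop :=
  forall x, c00 x ->
    N x = Num.max (sup [set modulus (x n) | n in [set: nat]])
            (2^-1 * sup [set \sum_(A <- E) N (coord_restriction A x)
                          | E in admissible]).

(* The conditions determine the values on c00 only, which are the only ones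
   used below. *)
Definition tsirelson_norm (R : realType) (F : scalar_field R) :
    sequences F -> R :=
  xget (fun=> 0) [set N | norm_on_c00 N /\ tsirelson_equation N].

Definition truncation (R : realType) (F : scalar_field R) (n : nat)
    (x : sequences F) : sequences F :=
  fun i => if (i < n)%N then x i else 0.

(* An element of the completion of c00 is identified with the sequence of its
   coefficients in the unit vector basis: a sequence is in the space when the
   partial sums of its expansion form a Cauchy sequence, and its norm is the
   limit of their norms. *)
Definition tsirelson_space (R : realType) (F : scalar_field R) :
    set (sequences F) :=
  [set x | forall e : R, 0 < e -> exists K, forall m n, (K <= m)%N -> (K <= n)%N ->
     tsirelson_norm (truncation m x - truncation n x) < e].

Definition tsirelson_space_norm (R : realType) (F : scalar_field R)
    (x : sequences F) : R :=
  limn (fun n => tsirelson_norm (truncation n x)).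

(* The quasi-norm is relevant on the set of points only. *)
Record qspace (R : realType) (F : scalar_field R) := QSpace {
  ambient : lmodType F;
  points : set ambient;
  qnorm : ambient -> R }.
Arguments points {R F} X _ : rename.

Definition abs_power (R : realType) (F : scalar_field R) (p : R)
    (f : sequences F) : sequences F :=
  fun n => of_real F (modulus (f n) `^ p).

Definition convexified_tsirelson (R : realType) (F : scalar_field R) (p : R) :
    qspace F :=
  @QSpace R F (sequences F)
    [set f | tsirelson_space (abs_power p f)]
    (fun f => tsirelson_space_norm (abs_power p f) `^ p^-1).

Definition linear_on (R : realType) (F : scalar_field R) (X : qspace F)
    (u : ambient X -> F) : Prop :=
  forall (a : F) f g, points X f -> points X g ->
    u (a *: f + g) = a * u f + u g.

(* x is the basis and xs the sequence of its coordinate functionals; xs is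
   determined on the space by x. *)
Definition is_basis (R : realType) (F : scalar_field R) (X : qspace F)
    (x : nat -> ambient X) (xs : nat -> ambient X -> F) : Prop :=
  [/\ (forall n, points X (x n)) /\ exists C : R, forall n, qnorm (x n) <= C,
      forall f, points X f -> forall e : R, 0 < e ->
        exists (A : {fset nat}) (c : nat -> F),
          qnorm (f - \sum_(n <- A) c n *: x n) < e,
      (forall n, linear_on (xs n)) /\
        exists C : R, forall n f, points X f -> modulus (xs n f) <= C * qnorm f &
      forall n k, xs n (x k) = (n == k)%:R].

Definition coord_projection (R : realType) (F : scalar_field R) (X : qspace F)
    (x : nat -> ambient X) (xs : nat -> ambient X -> F) (A : {fset nat})
    (f : ambient X) : ambient X :=
  \sum_(n <- A) xs n f *: x n.

Definition unconditional_basis (R : realType) (F : scalar_field R) (X : qspace F)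
    (x : nat -> ambient X) (xs : nat -> ambient X -> F) : Prop :=
  forall f, points X f -> forall s : nat -> nat, bijective s ->
    (fun n => qnorm (f - \sum_(j < n) xs (s j) f *: x (s j))) @ \oo --> (0 : R).

Definition is_greedy_ordering (R : realType) (F : scalar_field R)
    (c : nat -> F) (rho : nat -> nat) : Prop :=
  [/\ injective rho,
      [set n | c n != 0] `<=` range rho &
      forall j k, (j < k)%N ->
        modulus (c (rho k)) < modulus (c (rho j)) \/
        modulus (c (rho j)) = modulus (c (rho k)) /\ (rho j < rho k)%N].

(* There is exactly one greedy ordering when c tends to 0, as the coefficients
   of a vector in a basis do. *)
Definition greedy_ordering (R : realType) (F : scalar_field R)
    (c : nat -> F) : nat -> nat :=
  xget (id : nat -> nat) [set rho | is_greedy_ordering c rho].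

Definition greedy_sum (R : realType) (F : scalar_field R) (X : qspace F)
    (x : nat -> ambient X) (xs : nat -> ambient X -> F) (m : nat)
    (f : ambient X) : ambient X :=
  let rho := greedy_ordering (fun n => xs n f) in
  \sum_(j < m) xs (rho j) f *: x (rho j).

Definition almost_greedy_basis (R : realType) (F : scalar_field R) (X : qspace F)
    (x : nat -> ambient X) (xs : nat -> ambient X -> F) : Prop :=
  exists2 C : R, 1 <= C & forall f, points X f -> forall m, (0 < m)%N ->
    qnorm (f - greedy_sum x xs m f) <=
      C * inf [set qnorm (f - coord_projection x xs A f)
                | A in [set A : {fset nat} | #|` A| = m]].

Definition fundamental_function (R : realType) (F : scalar_field R)
    (X : qspace F) (x : nat -> ambient X) (m : nat) : \bar R :=
  ereal_sup [set (qnorm (\sum_(n <- A) x n))%:E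
              | A in [set A : {fset nat} | (#|` A| <= m)%N]].

Definition operator_norm (R : realType) (F : scalar_field R) (X : qspace F)
    (T : ambient X -> ambient X) : \bar R :=
  ereal_sup [set (qnorm (T f))%:E | f in [set f | points X f /\ qnorm f <= 1]].

Definition conditionality_constant (R : realType) (F : scalar_field R)
    (X : qspace F) (x : nat -> ambient X) (xs : nat -> ambient X -> F)
    (m : nat) : \bar R :=
  ereal_sup [set operator_norm (coord_projection x xs A)
              | A in [set A : {fset nat} | (#|` A| <= m)%N]].

Definition equivalent_from (R : realType) (m0 : nat) (a : nat -> \bar R)
    (b : nat -> R) : Prop :=
  exists c C : R, [/\ 0 < c, c <= C & forall m, (m0 <= m)%N ->
    ((c * b m)%:E <= a m)%E /\ (a m <= (C * b m)%:E)%E].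

Definition log2 (R : realType) (x : R) : R := ln x / ln 2.

Definition concave_on_ray (R : realType) (eta : R -> R) : Prop :=
  @convex_function R R^o [set` `[1, +oo[%R] (fun t => - eta t).

(* When eta is bounded, conditionality constants equivalent to
   (eta (log m))^(1/p) are bounded, which makes the basis unconditional. *)
Definition unbounded_on_ray (R : realType) (eta : R -> R) : Prop :=
  forall M : R, exists2 t, 1 <= t & M < eta t.

(* Main.v *)
Require Import Defs.
From HB Require Import structures.
From mathcomp Require Import all_boot all_order all_algebra finmap.
From mathcomp Require Import all_classical all_reals all_analysis.
From mathcomp Require Import complex zify ring lra.

Set Implicit Arguments.
Unset Strict Implicit.
Unset Printing Implicit Defensive.

Import Order.TTheory GRing.Theory Num.Theory.
Import numFieldNormedType.Exports.

Local Open Scope classical_set_scope.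
Local Open Scope ring_scope.

(* The p-convexified Tsirelson space contains uniform copies of l_p^N on the
   intervals [4^j, 4^j + M_j) with M_j <= 4^j, and because these intervals are
   so sparse its quasi-norm depends, up to a constant, only on the l_p norms of
   the restrictions of a vector to them and on the remaining coordinates.  On
   each interval put a complete b_j-ary tree of depth d_j and replace the unit
   vectors e_k by x_k = e_k - b_j^(-1/p) * (sum of the e_n, n a child of k).
   If c_n are the coefficients of f and v_n = |c_n|^p, then
   |f_n|^p >= |v_n - v_parent / b_j|, and with (t)_+ the positive part
     (v_n - s/b_j)_+ <= |f_n|^p + (v_parent - s)_+ / b_j,
   which telescopes over the tree.  So every layer s/b_j <= v_n <= s contributes
   at most the p-th power of the l_p norm of f.  This one fact yields that the
   basis is quasi-greedy and democratic, and that projecting on m coefficients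
   costs at most min(d_j, log_(b_j) m) layers.  Conversely the root vector e_k
   has coefficients of weight b_j^(-level), and its projection on the even
   levels has p-th power of the norm at least (d_j + 1) / 2.  With d_j of order
   eta(j) and b_j = 2^(j / d_j), concavity of eta gives the two-sided estimate. *)

(** * Norming functionals of Tsirelson's norm *)

(** All estimates are made for p-th powers. As p <= 1 these are subadditive, and the factor
    b_j^(-1/p) turns into 1/b_j, the equal share of each child in the weight of its parent, so p
    disappears and only l_1 estimates for nonnegative weights remain. The obstacle is that
    Tsirelson's norm is implicit, with no formula across different blocks. Estimates are therefore
    proved tree by tree, with one threshold s for all trees, and transferred to the whole space by
    comparing block sums. Counting coefficients across blocks needs one more fact: the sum of n
    distinct unit vectors has Tsirelson norm at least n/4, wherever they are. The parameters answer
    two demands. The tree of block j must have fewer than 2^(j+1) nodes, so that m coefficients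
    suffice for its even levels when j + 1 is the integer part of log m; hence b_j^(d_j) is about
    2^j. In a later block m coefficients account for about d_j (log m) / j levels, which stays below
    a multiple of eta(log m) because concavity makes eta(t)/t decreasing up to a constant. *)

Section Norming.
Variable R : realType.
Implicit Types (phi psi v w : nat -> R) (C D : R) (kappa : nat -> nat).

(* The families E_1 < ... < E_k with k <= min E_1 are encoded by a
   nondecreasing colouring kappa, E_i being the set of the n with colour i and
   k <= n.+1; enlarging the sets in this way does not change the supremum. *)
Inductive norming : (nat -> R) -> Prop :=
| norming_unit m : norming (fun n => (n == m)%:R)
| norming_half k kappa (phis : nat -> nat -> R) :
    {homo kappa : m n / (m <= n)%N} -> (forall i, norming (phis i)) ->
    norming (fun n => if (k <= n.+1)%N && (kappa n < k)%N
                      then 2^-1 * phis (kappa n) n else 0).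

Lemma norming_bounds phi n : norming phi -> 0 <= phi n <= 1.
Proof.
elim=> [m|k kappa phis _ _ IH]; first by case: eqP; rewrite ?ler01 lexx.
case: ifP => _; last by rewrite lexx ler01.
by have := IH (kappa n); lra.
Qed.

Lemma norming_ge0 phi n : norming phi -> 0 <= phi n.
Proof. by move=> /(norming_bounds n)/andP[]. Qed.

Lemma norming_le1 phi n : norming phi -> phi n <= 1.
Proof. by move=> /(norming_bounds n)/andP[]. Qed.

(* The norm of v is at most C; unlike tnorm below, this makes sense when the
   norm is infinite. *)
Definition tle v C := forall phi, norming phi ->
  forall N, \sum_(0 <= n < N) phi n * v n <= C.

Lemma tle_ge0 v C : tle v C -> 0 <= C.
Proof. by move=> /(_ _ (norming_unit 0) 0%N); rewrite big_geq. Qed.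

Lemma tle_coord v C n : tle v C -> v n <= C.
Proof.
move=> /(_ _ (norming_unit n) n.+1); rewrite big_nat_recr //= eqxx mul1r.
rewrite big_nat big1 ?add0r // => i /andP[_ lt_in].
by rewrite (ltn_eqF lt_in) mul0r.
Qed.

Lemma tle_weaken v C D : C <= D -> tle v C -> tle v D.
Proof. by move=> CD hv phi hphi N; apply: le_trans (hv _ hphi N) CD. Qed.

Lemma tle_mono v w C : (forall n, v n <= w n) -> tle w C -> tle v C.
Proof.
move=> vw hw phi hphi N; apply: le_trans (hw _ hphi N).
by apply: ler_sum => n _; apply: ler_wpM2l; rewrite ?norming_ge0.
Qed.

Lemma tleD v w C D : tle v C -> tle w D -> tle (fun n => v n + w n) (C + D).
Proof.
move=> hv hw phi hphi N; under eq_bigr do rewrite mulrDr.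
by rewrite big_split lerD ?hv ?hw.
Qed.

Lemma tleZ v C a : 0 <= a -> tle v C -> tle (fun n => a * v n) (a * C).
Proof.
move=> a0 hv phi hphi N; under eq_bigr do rewrite mulrCA.
by rewrite -mulr_sumr ler_wpM2l // hv.
Qed.

Lemma tle_l1 v C : (forall n, 0 <= v n) ->
  (forall N, \sum_(0 <= n < N) v n <= C) -> tle v C.
Proof.
move=> v0 hv phi hphi N; apply: le_trans (hv N); apply: ler_sum => n _.
by rewrite ler_piMl // norming_le1.
Qed.

Definition headpart K v : nat -> R := fun n => if (n < K)%N then v n else 0.
Definition tailpart K v : nat -> R := fun n => if (K <= n)%N then v n else 0.

Lemma headpart_le K v n : 0 <= v n -> headpart K v n <= v n.
Proof. by rewrite /headpart; case: ifP. Qed.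

Lemma tle_headpart v C : (forall K, tle (headpart K v) C) -> tle v C.
Proof.
move=> hv phi hphi N; apply: le_trans (hv N _ hphi N).
rewrite big_nat [leRHS]big_nat; apply: ler_sum => n /andP[_ ltnN].
by rewrite /headpart ltnN.
Qed.

Lemma sum_headpart K v N : (forall n, 0 <= v n) ->
  \sum_(0 <= n < N) headpart K v n <= \sum_(0 <= n < K) v n.
Proof.
move=> v0; have [leNK|ltKN] := leqP N K.
  rewrite (big_cat_nat (leq0n N) leNK) /= -[leLHS]addr0 lerD ?sumr_ge0 //.
  by apply: ler_sum => n _; exact: headpart_le.
rewrite (big_cat_nat (leq0n K) (ltnW ltKN)) /= [X in _ + X]big_nat [X in _ + X]big1 ?addr0.
  by apply: ler_sum => n _; exact: headpart_le.
by move=> n /andP[leKn _]; rewrite /headpart ltnNge leKn.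
Qed.

Definition tbounded v := exists C, tle v C.

Lemma tbounded_headpart K v : (forall n, 0 <= v n) -> tbounded (headpart K v).
Proof.
move=> v0; exists (\sum_(0 <= n < K) v n); apply: tle_l1 => [n|N].
  by rewrite /headpart; case: ifP.
exact: sum_headpart.
Qed.

Definition tnorm v := sup [set s | exists2 phi, norming phi &
  exists N, s = \sum_(0 <= n < N) phi n * v n].

Lemma tnorm_has_sup v C : tle v C ->
  has_sup [set s | exists2 phi, norming phi &
                     exists N, s = \sum_(0 <= n < N) phi n * v n].
Proof.
move=> hv; split; last by exists C => _ [phi hphi [N ->]]; exact: hv.
by exists (\sum_(0 <= n < 0) (n == 0%N)%:R * v n), (fun n => (n == 0%N)%:R);
  [exact: norming_unit | exists 0%N].
Qed.

Lemma tle_tnorm v : tbounded v -> tle v (tnorm v).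
Proof.
move=> [C hv] phi hphi N; apply: ub_le_sup; first by case: (tnorm_has_sup hv).
by exists phi => //; exists N.
Qed.

Lemma tnorm_le v C : tle v C -> tnorm v <= C.
Proof.
move=> hv; apply: ge_sup; first by case: (tnorm_has_sup hv).
by move=> _ [phi hphi [N ->]]; exact: hv.
Qed.

Lemma tnorm_ge0 v : tbounded v -> 0 <= tnorm v.
Proof. by move=> /tle_tnorm/tle_ge0. Qed.

Lemma tnorm_ext v w : (forall n, v n = w n) -> tnorm v = tnorm w.
Proof. by move=> vw; congr tnorm; apply: funext. Qed.

(** Functionals that almost attain the norms of the k pieces are glued by [norming_half] into one
    functional on v; its factor 1/2 is the 2 on the right. *)
Lemma sum_tnorm_colour v k kappa : (forall n, 0 <= v n) -> tbounded v ->
  {homo kappa : m n / (m <= n)%N} ->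
  \sum_(0 <= i < k) tnorm (fun n => if (k <= n.+1)%N && (kappa n == i)
                                    then v n else 0) <= 2 * tnorm v.
Proof.
move=> v0 bv homo_kappa.
set part := fun i n => if (k <= n.+1)%N && (kappa n == i) then v n else 0.
have part_le i n : part i n <= v n by rewrite /part; case: ifP.
have bpart i : tbounded (part i).
  by exists (tnorm v); apply: tle_mono (part_le i) (tle_tnorm bv).
apply/ler_addgt0Pr => e e0.
have {}e0 : 0 < e / k.+1%:R by rewrite divr_gt0.
have /choice[f fP] i : exists fN : (nat -> R) * nat, norming fN.1 /\
    tnorm (part i) - e / k.+1%:R < \sum_(0 <= n < fN.2) fN.1 n * part i n.
  have [C hC] := bpart i.
  have [_ [phi hphi [N ->]] lt] := sup_adherent e0 (tnorm_has_sup hC).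
  by exists (phi, N).
pose N := (\max_(i < k) (f i).2)%N.
have tp i : (i < k)%N ->
    tnorm (part i) - e / k.+1%:R <= \sum_(0 <= n < N) (f i).1 n * part i n.
  move=> ltik; have [hf lt] := fP i; apply: le_trans (ltW lt) _.
  have leN : ((f i).2 <= N)%N by exact: (leq_bigmax (Ordinal ltik)).
  rewrite [leRHS](big_cat_nat (leq0n _) leN) /= lerDl sumr_ge0 // => n _.
  by apply: mulr_ge0; [exact: norming_ge0 | rewrite /part; case: ifP].
have hphi := @norming_half k kappa (fun i => (f i).1) homo_kappa
  (fun i => (fP i).1).
have := tle_tnorm bv hphi N.
rewrite -(ler_pM2l (x := 2)) // mulr_sumr => le2.
have -> : \sum_(0 <= i < k) tnorm (part i) =
    \sum_(0 <= i < k) (tnorm (part i) - e / k.+1%:R) + k%:R * (e / k.+1%:R).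
  set a := e / _.
  rewrite (_ : k%:R * a = \sum_(0 <= i < k) a); last first.
    by rewrite sumr_const_nat subn0 mulr_natl.
  by rewrite -big_split; apply: eq_bigr => i _ /=; rewrite subrK.
apply: lerD; last first.
  by rewrite mulrCA ger_pMr // ?ler_pdivrMr // ?mul1r ?ler_nat //; have := e0;
    rewrite pmulr_lgt0 // invr_gt0.
apply: le_trans le2.
apply: (@le_trans _ _ (\sum_(0 <= i < k) \sum_(0 <= n < N) (f i).1 n * part i n)).
  by rewrite big_nat [leRHS]big_nat; apply: ler_sum => i /andP[_]; exact: tp.
rewrite exchange_big /=; apply: ler_sum => n _.
rewrite /part; case: ifP => [/andP[lekn ltk]|] /=.
  rewrite (bigD1_seq (kappa n)) ?mem_index_iota ?iota_uniq //= lekn eqxx /=.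
  rewrite big1 ?addr0 => [|i /negbTE ne]; first by lra.
  by rewrite eq_sym ne mulr0.
move=> nk; rewrite mul0r mulr0 big_nat big1 // => i /andP[_ ltik].
case: ifP; rewrite ?mulr0 // => /andP[lekn /eqP ki].
by rewrite lekn ki ltik in nk.
Qed.

(** The k singletons from index a on form an admissible family, since a stands for the integer a + 1
    >= k. This is the source of the copies of l_p^N. *)
Lemma tle_interval v C a k : (k <= a.+1)%N -> tle v C ->
  \sum_(0 <= i < k) v (a + i)%N <= 2 * C.
Proof.
move=> leka hv.
(* Truncated subtraction gives every n < a the colour 0 as well; the functional of that colour is
   the unit one at a, which vanishes there. *)
have homo_k : {homo (fun n => (n - a)%N) : m n / (m <= n)%N} by move=> m n; lia.
have := hv _ (@norming_half k _ (fun i n => (n == a + i)%:R) homo_k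
  (fun i => norming_unit _)) (a + k)%N.
rewrite (big_cat_nat (leq0n a) (leq_addr _ _)) /= big_nat big1 ?add0r; last first.
  move=> n /andP[_ ltna]; case: ifP => _; rewrite ?mul0r //.
  by rewrite (_ : n == _ = false) ?mulr0 ?mul0r //; lia.
rewrite -{1}[a]add0n big_addn addKn => le.
rewrite -(ler_pM2l (x := 2^-1)) // mulrA mulVf // mul1r mulr_sumr.
apply: le_trans le; rewrite le_eqVlt; apply/orP; left; apply/eqP.
apply: eq_big_nat => i /andP[_ ltik].
rewrite addnK (addnC i a) eqxx mulr1 ifT //; lia.
Qed.

(** The larger half of B suffices: each of its k elements has at least k - 1 elements of B below it,
    so it stands for an integer >= k and the singletons are admissible. Halving B and the factor 1/2
    of the norm make the 4. *)
Lemma tle_card (B : {fset nat}) C : tle (fun n => (n \in B)%:R) C ->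
  (#|` B|)%:R <= 4 * C.
Proof.
move=> hB; pose L := sort leq (enum_fset B).
have uL : uniq L by rewrite sort_uniq fset_uniq.
have sL : sorted ltn L by rewrite ltn_sorted_uniq_leq uL sort_sorted //; exact: leq_total.
have szL : size L = #|` B| by rewrite size_sort cardfE.
have nthL i j : (i < j < size L)%N -> (nth 0 L i < nth 0 L j)%N.
  move=> /andP[ij js]; apply: (sorted_ltn_nth ltn_trans) => //.
  by rewrite inE (ltn_trans ij).
have leL i : (i < size L)%N -> (i <= nth 0 L i)%N.
  elim: i => // i IH lt; apply: leq_ltn_trans (IH (ltnW lt)) _.
  by apply: nthL; rewrite ltnSn.
pose h := (size L)./2; pose k := (size L - h)%N.
have hE : (size L = h + k)%N by rewrite /k /h; lia.
have khE : (h <= k <= h.+1)%N by rewrite /k /h; lia.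
(* This counts the chosen points below n, so the i-th chosen point has colour i. *)
pose kappa n := count (fun x => x < n)%N (drop h L).
have homo_k : {homo kappa : m n / (m <= n)%N}.
  by move=> m n mn; apply: sub_count => x /leq_trans; apply.
have := hB _ (@norming_half k _ (fun i n => (n == nth 0 L (h + i))%:R) homo_k
  (fun i => norming_unit _)) (\max_(x <- L) x).+1%N.
have kappaE i : (i < k)%N -> kappa (nth 0 L (h + i)) = i.
  move=> ltik; rewrite /kappa -[drop h L](cat_take_drop i) count_cat.
  have -> : count (fun x => x < nth 0 L (h + i))%N (take i (drop h L)) = i.
    have sz : size (take i (drop h L)) = i.
      by rewrite size_takel // size_drop; lia.
    rewrite -[RHS]sz; apply/eqP; rewrite -all_count; apply/(all_nthP 0) => l.
    rewrite sz => li; rewrite nth_take // nth_drop; apply: nthL; lia.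
  rewrite drop_drop (_ : count _ _ = 0)%N ?addn0 //; apply/eqP.
  rewrite -leqn0 leqNgt -has_count; apply/hasPn => x /(nthP 0)[l].
  rewrite size_drop => ls <-; rewrite nth_drop -leqNgt.
  case: l ls => [|l] ls; first by rewrite addn0 addnC.
  apply: ltnW; apply: nthL; rewrite ltn_subRL in ls; rewrite addnC ls andbT; lia.
rewrite -(ler_pM2l (x := 4)) //; apply: le_trans.
have subL x : x \in drop h L -> x \in L by move=> /mem_drop.
rewrite (bigID (fun n => n \in drop h L)) /= -[leLHS]addr0 mulrDr; apply: lerD; last first.
  rewrite mulr_ge0 // sumr_ge0 // => n _; rewrite mulr_ge0 //.
  by case: ifP => // _; rewrite mulr_ge0 // invr_ge0.
rewrite -big_filter.
rewrite (perm_big (drop h L)); last first.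
  apply: uniq_perm; rewrite ?filter_uniq ?iota_uniq ?drop_uniq // => x.
  rewrite mem_filter mem_index_iota; case: (boolP (x \in drop h L)) => //= /subL xL.
  by rewrite ltnS; apply: leq_bigmax_seq.
rewrite (big_nth 0%N) size_drop -/k.
rewrite (eq_big_nat _ _ (F2 := fun _ => 2^-1)); last first.
  move=> i /andP[_ ltik]; rewrite nth_drop kappaE // eqxx ltik andbT.
  rewrite (_ : nth 0 L (h + i) \in B); last first.
    have : nth 0 L (h + i) \in L by rewrite mem_nth // hE ltn_add2l.
    by rewrite mem_sort.
  rewrite ifT ?mulr1 //; apply: leq_trans (_ : h.+1 <= _)%N; first by lia.
  rewrite ltnS; apply: leq_trans (leL _ _); lia.
rewrite sumr_const_nat subn0 -mulr_natl -szL {1}hE.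
have : (h%:R <= k%:R :> R) by rewrite ler_nat; lia.
rewrite natrD; lra.
Qed.

End Norming.

(** * Sparse blocks *)

(* In the 1-based indexing of the paper, block j is [4^j, 4^(j+1)). *)
Definition base j := (4 ^ j).-1.
Definition blk n := trunc_log 4 n.+1.
Definition off n := (n - base (blk n))%N.

Lemma baseS j : (base j).+1 = (4 ^ j)%N.
Proof. by rewrite /base prednK // expn_gt0. Qed.

Lemma base_next j : base j.+1 = (base j + 3 * 4 ^ j)%N.
Proof. by have := baseS j; have := baseS j.+1; rewrite expnS; lia. Qed.

Lemma base_blk n : (base (blk n) <= n)%N.
Proof.
by rewrite -ltnS baseS; have /andP[] := trunc_log_bounds (isT : 1 < 4)%N (ltn0Sn n).
Qed.

Lemma ltn_base_blk n : (n < base (blk n).+1)%N.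
Proof.
by rewrite -ltnS baseS; have /andP[] := trunc_log_bounds (isT : 1 < 4)%N (ltn0Sn n).
Qed.

Lemma blk_base_add j i : (i < 3 * 4 ^ j)%N -> blk (base j + i) = j.
Proof.
move=> lti; apply: trunc_log_eq => //.
by rewrite -addSn baseS leq_addr expnS /=; lia.
Qed.

Lemma blk_base j : blk (base j) = j.
Proof. by rewrite -[base j]addn0 blk_base_add // muln_gt0 expn_gt0. Qed.

Lemma off_base_add j i : (i < 3 * 4 ^ j)%N -> off (base j + i) = i.
Proof. by move=> lti; rewrite /off blk_base_add // addKn. Qed.

Lemma base_off n : (base (blk n) + off n)%N = n.
Proof. by rewrite subnKC // base_blk. Qed.

Lemma leq_blk : {homo blk : m n / (m <= n)%N}.
Proof. by move=> m n mn; apply: leq_trunc_log. Qed.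

Lemma leq_base : {homo base : i j / (i <= j)%N}.
Proof. by move=> i j ij; rewrite -ltnS !baseS leq_exp2l. Qed.

Lemma ltn_blk_base n j : (n < base j)%N = (blk n < j)%N.
Proof.
apply/idP/idP => lt.
  rewrite ltnNge; apply/negP => /leq_base le.
  by have := leq_trans le (base_blk n); rewrite leqNgt lt.
exact: leq_trans (ltn_base_blk n) (leq_base lt).
Qed.

Lemma leq_base_id j : (j <= base j)%N.
Proof. by rewrite -ltnS baseS ltn_expl. Qed.

Lemma arg_max_nat (R : realType) (g : nat -> R) m : (0 < m)%N ->
  exists2 i, (i < m)%N & forall k, (k < m)%N -> g k <= g i.
Proof.
case: m => // m _; elim: m => [|m [i ltim IH]].
  by exists 0%N => // k; rewrite ltnS leqn0 => /eqP->.
have [le|/ltW lt] := leP (g m.+1) (g i).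
  exists i; first exact: ltnW.
  by move=> k; rewrite ltnS leq_eqVlt => /predU1P[->//|]; exact: IH.
exists m.+1 => // k; rewrite ltnS leq_eqVlt => /predU1P[->//|/IH le].
exact: le_trans lt.
Qed.

Section Blocks.
Variables (R : realType) (M : nat -> nat).
Hypotheses (M_gt0 : forall j, (0 < M j)%N) (M_le : forall j, (M j <= 4 ^ j)%N).
Implicit Types (phi psi v y z h u : nat -> R) (C c : R) (kappa sigma : nat -> nat).

Lemma ltn_M_gap j i : (i < M j)%N -> (i < 3 * 4 ^ j)%N.
Proof. by have := M_le j; lia. Qed.

Definition bsum h j := \sum_(0 <= i < M j) h (base j + i)%N.

Lemma bsum_ge0 h j : (forall n, 0 <= h n) -> 0 <= bsum h j.
Proof. by move=> h0; apply: sumr_ge0. Qed.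

Lemma sum_blocks h J : \sum_(0 <= n < base J) h n =
  \sum_(0 <= j < J) \sum_(0 <= i < 3 * 4 ^ j) h (base j + i)%N.
Proof.
elim: J => [|J IH]; first by rewrite /base !big_geq.
rewrite big_nat_recr //= -IH base_next (big_cat_nat (leq0n _) (leq_addr _ _)) /=.
congr (_ + _); rewrite -{1}[base J]add0n big_addn addKn.
by apply: eq_bigr => i _; rewrite addnC.
Qed.

Lemma sum_trees h J :
  \sum_(0 <= n < base J) (if (off n < M (blk n))%N then h n else 0) =
  \sum_(0 <= j < J) bsum h j.
Proof.
rewrite sum_blocks; apply: eq_bigr => j _.
have leM : (M j <= 3 * 4 ^ j)%N by have := M_le j; lia.
rewrite (big_cat_nat (leq0n _) leM) /= [X in _ + X]big_nat [X in _ + X]big1 ?addr0.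
  apply: eq_big_nat => i /andP[_ lti].
  by rewrite off_base_add ?blk_base_add ?lti // ltn_M_gap.
move=> i /andP[leMi lti]; rewrite off_base_add // blk_base_add //.
by rewrite ltnNge leMi.
Qed.

Lemma tle_blocks v C : (forall n, 0 <= v n) ->
  (forall phi, norming phi -> forall J, \sum_(0 <= n < base J) phi n * v n <= C) ->
  tle v C.
Proof.
move=> v0 hv phi hphi N; apply: le_trans (hv _ hphi N).
rewrite [leRHS](big_cat_nat (leq0n _) (leq_base_id N)) /= lerDl sumr_ge0 // => n _.
by rewrite mulr_ge0 // norming_ge0.
Qed.

Definition root_seq u : nat -> R :=
  fun n => if n == base (blk n) then u (blk n) else 0.

Lemma sum_root_seq phi u J : \sum_(0 <= n < base J) phi n * root_seq u n =
  \sum_(0 <= j < J) phi (base j) * u j.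
Proof.
rewrite sum_blocks; apply: eq_bigr => j _.
have gt0 : (0 < 3 * 4 ^ j)%N by rewrite muln_gt0 expn_gt0.
rewrite big_ltn // addn0 /root_seq blk_base eqxx.
rewrite big_nat big1 ?addr0 // => i /andP[i0 lti].
by rewrite blk_base_add // ifF ?mulr0 //; apply/eqP; lia.
Qed.

(* Replacing a unit functional at the root of a block by half the sum over the
   block is one more admissible step. *)
Lemma norming_spread phi : norming phi -> exists2 psi, norming psi &
  forall j i, (i < M j)%N -> 2^-1 * phi (base j) <= psi (base j + i)%N.
Proof.
elim=> {phi} [m|k kappa phis homo_kappa _ IH].
  have [mE|mNE] := eqVneq m (base (blk m)).
    have homo_k : {homo (fun n => (n - m)%N) : m n / (m <= n)%N} by move=> *; lia.
    eexists; first exact: (@norming_half _ (M (blk m)) _ (fun i n => (n == m + i)%:R) homo_k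
      (fun i => norming_unit _ _)).
    move=> j i lti /=; have [jm|ne] := eqVneq (base j) m; last first.
      by rewrite mulr0; case: ifP => // _; rewrite mulr_ge0 // invr_ge0.
    rewrite -jm blk_base addKn eqxx lti mulr1 andbT ifT ?mulr1 //.
    by have := baseS j; have := M_le j; lia.
  exists (fun n => (n == m)%:R); first exact: norming_unit.
  move=> j i _; rewrite (_ : base j == m = false) ?mulr0 //.
  by apply/eqP => jm; move: mNE; rewrite -jm blk_base eqxx.
have /choice[psis psisP] i : exists psi, norming psi /\
    forall j l, (l < M j)%N -> 2^-1 * phis i (base j) <= psi (base j + l)%N.
  by have [psi] := IH i; exists psi.
have homo_k : {homo (fun n => kappa (base (blk n))) : m n / (m <= n)%N}.
  by move=> m n mn; apply/homo_kappa/leq_base/leq_blk.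
eexists; first exact: (norming_half k homo_k (fun i => (psisP i).1)).
move=> j l ltl; have ltl' := ltn_M_gap ltl.
rewrite blk_base_add //; case: ifP => [/andP[lek ltk]|_].
  rewrite ltk (leq_trans lek) //=; last by rewrite ltnS leq_addr.
  by rewrite ler_pM2l ?invr_gt0 //; exact: (psisP _).2.
rewrite mulr0; case: ifP => // _; rewrite mulr_ge0 ?invr_ge0 //.
by have := norming_ge0 (base j + l)%N (psisP (kappa (base j))).1.
Qed.

Lemma tle_root_seq z C : (forall n, 0 <= z n) -> tle z C ->
  tle (root_seq (bsum z)) (2 * C).
Proof.
move=> z0 hz; apply: tle_blocks => [n|phi hphi J].
  by rewrite /root_seq; case: ifP => // _; exact: bsum_ge0.
rewrite sum_root_seq; have [psi hpsi le] := norming_spread hphi.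
rewrite -ler_pdivrMl //; apply: le_trans (hz _ hpsi (base J)).
apply: (@le_trans _ _
  (\sum_(0 <= n < base J) if (off n < M (blk n))%N then psi n * z n else 0)).
  rewrite sum_trees mulr_sumr; apply: ler_sum => j _.
  rewrite mulrA mulr_sumr [leLHS]big_nat [leRHS]big_nat.
  apply: ler_sum => i /andP[_ lti]; apply: ler_wpM2r => //; exact: le.
apply: ler_sum => n _; case: ifP => // _.
by rewrite mulr_ge0 // norming_ge0.
Qed.

(* Moving the points sigma j of the blocks to the left ends base j destroys
   admissibility by a factor 2 at most; giving up the first relevant point j1
   makes up for it, since base (j1 + 1) is large compared to sigma j1. *)
Lemma norming_shift phi : norming phi -> forall sigma,
  (forall j, (base j <= sigma j < base j + M j)%N) -> forall J : nat -> bool,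
  exists j1, exists2 psi, norming psi & forall j, J j -> phi (sigma j) != 0 ->
    (j1 <= j)%N /\ ((j1 < j)%N -> phi (sigma j) <= psi (base j)).
Proof.
move=> hphi sigma hsigma.
have blk_sigma j : blk (sigma j) = j.
  have /andP[le lt] := hsigma j; rewrite -[sigma j](subnKC le) blk_base_add //.
  by apply: ltn_M_gap; lia.
elim: hphi => {phi} [m|k kappa phis homo_kappa hphis IH] J.
  exists (blk m), (fun n => (n == 0%N)%:R); first exact: norming_unit.
  move=> j _; have [<- _|_] := eqVneq (sigma j) m; last by rewrite eqxx.
  by rewrite blk_sigma ltnn.
pose phi n := if (k <= n.+1)%N && (kappa n < k)%N
              then 2^-1 * phis (kappa n) n else 0.
change (exists j1, exists2 psi, norming psi & forall j, J j ->
  phi (sigma j) != 0 -> (j1 <= j)%N /\ ((j1 < j)%N -> phi (sigma j) <= psi (base j))).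
have [[j0 /andP[Jj0 nz0]]|none] := pselect (exists j, J j && (phi (sigma j) != 0)); last first.
  exists 0%N, (fun n => (n == 0%N)%:R); first exact: norming_unit.
  by move=> j Jj nz; case: none; exists j; rewrite Jj nz.
have exJ : exists j, J j && (phi (sigma j) != 0) by exists j0; rewrite Jj0.
have [j1 /andP[Jj1 nz1] min_j1] := ex_minnP exJ.
have phi_nz j : phi (sigma j) != 0 ->
    [/\ (k <= (sigma j).+1)%N, (kappa (sigma j) < k)%N,
        phis (kappa (sigma j)) (sigma j) != 0 &
        phi (sigma j) = 2^-1 * phis (kappa (sigma j)) (sigma j)].
  rewrite /phi; case: ifP => [/andP[-> ->] nz|]; last by rewrite eqxx.
  by split => //; apply: contra_neq nz => ->; rewrite mulr0.
(* The induction hypothesis is applied to the relevant blocks of each colour i separately, which is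
   why J is a parameter; each colour has its own exceptional block [(jpsi i).1]. *)
have /choice[jpsi jpsiP] i : exists jpsi : nat * (nat -> R), norming jpsi.2 /\
    forall j, J j -> kappa (sigma j) = i -> phis i (sigma j) != 0 ->
    (jpsi.1 <= j)%N /\ ((jpsi.1 < j)%N -> phis i (sigma j) <= jpsi.2 (base j)).
  have [ji [psi hpsi P]] := IH i (fun j => J j && (kappa (sigma j) == i)).
  exists (ji, psi); split => // j Jj kj nz.
  by apply: P => //; rewrite Jj kj eqxx.
(* Colour i is split into 2i, for the root of its exceptional block, and 2i + 1, for the later
   roots. A unit functional serves the first and the inductive one the second, so k pieces become
   2k. *)
pose col n := let j := blk n in let i := kappa (sigma j) in
  (2 * i + ((jpsi i).1 < j)%N)%N.
have homo_col : {homo col : m n / (m <= n)%N}.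
  move=> m n /leq_blk; rewrite /col; set a := blk m; set b := blk n => ab.
  have : (kappa (sigma a) <= kappa (sigma b))%N.
    have [->//|ltab] := eqVneq a b; apply: homo_kappa.
    rewrite leq_eqVlt; apply/orP; right.
    have {}ltab : (a < b)%N by rewrite ltn_neqAle ltab.
    have /andP[le _] := hsigma b; apply: leq_trans le.
    by rewrite ltn_blk_base blk_sigma.
  rewrite leq_eqVlt => /predU1P[->|lt].
    by rewrite leq_add2l; case: ltnP => // lt; rewrite (leq_trans lt ab).
  by case: ltnP => _; case: ltnP => _; lia.
pose psis l : nat -> R := if odd l then (jpsi l./2%N).2
  else fun n => (n == base (jpsi l./2%N).1)%:R.
have hpsis l : norming (psis l).
  by rewrite /psis; case: ifP => _; [exact: (jpsiP _).1 | exact: norming_unit].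
exists j1; eexists; first exact: (norming_half (2 * k) homo_col hpsis).
move=> j Jj nz; split; first by apply: min_j1; rewrite Jj nz.
move=> lt1; have [_ ltk nzi ->] := phi_nz _ nz.
have [lek1 _ _ _] := phi_nz _ nz1.
have [lei dom] := (jpsiP _).2 _ Jj erefl nzi.
(* Here the base 4 is used: [sigma j1] lies in the first 4^j1 places of its block, so k < 2 * 4^j1
   and 2k <= 4^(j1+1). *)
have -> : (2 * k <= (base j).+1)%N.
  rewrite baseS; apply: leq_trans (_ : 4 ^ j1.+1 <= _)%N; last by rewrite leq_exp2l.
  have /andP[_ lt] := hsigma j1; have := baseS j1; have := M_le j1.
  by rewrite expnS; lia.
rewrite /col blk_base; set i := kappa _ in ltk nzi lei dom *.
have -> /= : (2 * i + ((jpsi i).1 < j) < 2 * k)%N by case: ltnP; lia.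
rewrite ler_pM2l ?invr_gt0 // /psis oddD mul2n odd_double.
case: ltnP => [lt|ge] /=.
  by rewrite halfD odd_double doubleK /= addn0; exact: dom.
rewrite addn0 doubleK (_ : (jpsi i).1 = j) ?eqxx ?norming_le1 //.
by apply/eqP; rewrite eqn_leq lei ge.
Qed.

(** On each block the functional yields at most the block sum times its largest value, taken at
    sigma j. [norming_shift] moves these values to the roots; the one block it gives up is bounded
    by a coordinate of the root sequence, hence the 2. *)
Lemma tle_of_root_seq y C : (forall n, 0 <= y n) ->
  (forall n, (M (blk n) <= off n)%N -> y n = 0) ->
  tle (root_seq (bsum y)) C -> tle y (2 * C).
Proof.
move=> y0 ytree hy; apply: tle_blocks => // phi hphi J.
have /choice[sigma sigmaP] j : exists s, (base j <= s < base j + M j)%N /\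
    forall i, (i < M j)%N -> phi (base j + i)%N <= phi s.
  have [i lti P] := @arg_max_nat _ (fun i => phi (base j + i)%N) _ (M_gt0 j).
  by exists (base j + i)%N; rewrite leq_addr ltn_add2l lti.
have [j1 [psi hpsi P]] := norming_shift hphi (fun j => (sigmaP j).1) xpredT.
pose u := bsum y.
have u0 j : 0 <= u j by exact: bsum_ge0.
have le1 : \sum_(0 <= n < base J) phi n * y n <=
    \sum_(0 <= j < J) phi (sigma j) * u j.
  rewrite (eq_bigr (fun n => if (off n < M (blk n))%N then phi n * y n else 0)).
    rewrite sum_trees; apply: ler_sum => j _.
    rewrite mulr_sumr [leLHS]big_nat [leRHS]big_nat; apply: ler_sum => i /andP[_ lti].
    by apply: ler_wpM2r => //; exact: (sigmaP j).2.
  by move=> n _; case: ltnP => // le; rewrite ytree // mulr0.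
apply: (le_trans le1).
have u_le : u j1 <= C.
  by have := tle_coord (base j1) hy; rewrite /root_seq blk_base eqxx.
have C0 := tle_ge0 hy.
apply: (@le_trans _ _ (\sum_(0 <= j < J) ((j == j1)%:R * C + psi (base j) * u j))).
  apply: ler_sum => j _; have [->|ne] := eqVneq j j1.
    rewrite mul1r (le_trans (_ : _ <= u j1)) //.
      by rewrite ler_piMl // norming_le1.
    rewrite (le_trans u_le) // lerDl; apply: mulr_ge0 => //; exact: norming_ge0.
  rewrite mul0r add0r; have [->|nz] := eqVneq (phi (sigma j)) 0.
    by rewrite mul0r; apply: mulr_ge0 => //; exact: norming_ge0.
  have [le dom] := P j isT nz; apply: ler_wpM2r => //; apply: dom.
  by rewrite ltn_neqAle eq_sym ne.
rewrite big_split /= mulr_natl mulr2n lerD //.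
  rewrite -mulr_suml ler_piMl // -natr_sum -[1]/(1%:R) ler_nat.
  rewrite -(big_mkcond (fun j => j == j1) (fun=> 1%N)) /=.
  have [lt|ge] := ltnP j1 J.
    by rewrite -big_filter filter_pred1_uniq ?iota_uniq ?mem_index_iota //= big_seq1.
  rewrite big_nat_cond big_pred0 // => j; apply/negP => /andP[/andP[_ lt] /eqP jj1].
  by rewrite -jj1 leqNgt lt in ge.
by rewrite -sum_root_seq; exact: hy.
Qed.

(** The transfer principle: inequalities between block sums become inequalities between norms. The
    constant is 5 = 2 * 2 + 1, for moving the sums of z to the roots, moving those of y back, and
    the coordinates off the trees. *)
Lemma tle_block_dominated y z c C : 0 <= c ->
  (forall n, 0 <= y n) -> (forall n, 0 <= z n) ->
  (forall j, bsum y j <= c * bsum z j) ->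
  (forall n, (M (blk n) <= off n)%N -> y n <= c * z n) ->
  tle z C -> tle y (5 * c * C).
Proof.
move=> c0 y0 z0 yz_tree yz_off hz; have C0 := tle_ge0 hz.
pose yt n := if (off n < M (blk n))%N then y n else 0.
pose yo n := if (off n < M (blk n))%N then 0 else y n.
have -> : y = (fun n => yt n + yo n).
  by apply: funext => n; rewrite /yt /yo; case: ifP; rewrite ?addr0 ?add0r.
have -> : 5 * c * C = 2 * (c * (2 * C)) + c * C by ring.
apply: tleD; last first.
  apply: tle_mono (tleZ c0 hz) => n; rewrite /yo; case: ltnP => [_|/yz_off//].
  exact: mulr_ge0.
apply: tle_of_root_seq => [n|n|].
- by rewrite /yt; case: ifP.
- by rewrite /yt ltnNge => ->.
apply: tle_mono (tleZ c0 (tle_root_seq z0 hz)) => n.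
rewrite /root_seq; case: ifP => _; last by rewrite mulr0.
apply: le_trans (yz_tree _); rewrite le_eqVlt; apply/orP; left; apply/eqP.
apply: eq_big_nat => i /andP[_ lti].
by rewrite /yt off_base_add ?blk_base_add ?lti // ltn_M_gap.
Qed.

Lemma bsum_le y C j : (forall n, 0 <= y n) -> tle y C -> bsum y j <= 2 * C.
Proof.
by move=> y0; apply: tle_interval; rewrite baseS.
Qed.

End Blocks.

(** * Tsirelson's norm on c00 and on its completion *)

Record good_scalars (R : realType) (F : scalar_field R) : Prop := GoodScalars {
  modulus_ge0 : forall a : F, 0 <= modulus a;
  modulus_eq0 : forall a : F, modulus a = 0 -> a = 0;
  modulusM : forall a b : F, modulus (a * b) = modulus a * modulus b;
  modulusD : forall a b : F, modulus (a + b) <= modulus a + modulus b;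
  modulus_real : forall r : R, modulus (of_real F r) = `|r| }.

Lemma good_real_scalars (R : realType) : good_scalars (real_scalars R).
Proof.
split=> //= [a|a b|a b]; [exact: normr0_eq0 | exact: normrM | exact: ler_normD].
Qed.

Lemma good_complex_scalars (R : realType) : good_scalars (complex_scalars R).
Proof.
split=> /=.
- by case=> a b; exact: sqrtr_ge0.
- by move=> a; exact: ComplexField.Normc.eq0_normc.
- by move=> a b; exact: ComplexField.Normc.normcM.
- by move=> a b; exact: le_normcD.
- by move=> r; rewrite /ComplexField.Normc.normc expr0n addr0 sqrtr_sqr.
Qed.

Section Modulus.
Variables (R : realType) (F : scalar_field R).
Hypothesis hF : good_scalars F.
Implicit Types a b : F.

Lemma modulus0 : modulus (0 : F) = 0.
Proof.
have h : modulus (of_real F 0) = 0 by rewrite (modulus_real hF) normr0.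
by rewrite -{1}(modulus_eq0 hF h) h.
Qed.

Lemma modulus1 : modulus (1 : F) = 1.
Proof.
have nz : modulus (1 : F) != 0.
  by apply/eqP => /(modulus_eq0 hF)/eqP; rewrite oner_eq0.
by apply: (mulfI nz); rewrite -(modulusM hF) !mulr1.
Qed.

Lemma modulusN a : modulus (- a) = modulus a.
Proof.
rewrite -mulN1r (modulusM hF); have sq : modulus (-1 : F) ^+ 2 = 1.
  by rewrite expr2 -(modulusM hF) mulrNN mulr1 modulus1.
have /eqP := sq; rewrite sqrf_eq1 => /orP[/eqP->|/eqP h]; first by rewrite mul1r.
by have := modulus_ge0 hF (-1); rewrite h oppr_ge0 ler10.
Qed.

End Modulus.

Section TsirelsonNorm.
Variables (R : realType) (F : scalar_field R).
Hypothesis hF : good_scalars F.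
Implicit Types (x y : sequences F) (v w : nat -> R).

Lemma seqBE x y n : (x - y) n = x n - y n. Proof. by []. Qed.
Lemma seqNE x n : (- x) n = - x n. Proof. by []. Qed.

Definition moduli x : nat -> R := fun n => modulus (x n).

Lemma moduli_ge0 x n : 0 <= moduli x n.
Proof. exact: modulus_ge0. Qed.
#[local] Hint Resolve moduli_ge0 : core.

Lemma c00P x : c00 x <-> exists K, forall n, (K <= n)%N -> x n = 0.
Proof.
split=> [/finite_fsetP[A hA]|[K hK]].
  exists (\max_(n <- A) n).+1 => n ltn; apply/eqP/negPn/negP => nz.
  have : [set` A] n by rewrite -hA.
  move=> /= nA; have := @leq_bigmax_seq _ (enum_fset A) predT id n nA isT.
  by rewrite leqNgt ltn.
apply: (@sub_finite_set _ _ `I_K) => [n /= nz|]; last exact: finite_II.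
by rewrite ltnNge; apply/negP => /hK xn; rewrite xn eqxx in nz.
Qed.

Lemma moduli_headpart x K : (forall n, (K <= n)%N -> x n = 0) -> moduli x = headpart K (moduli x).
Proof.
move=> hK; apply: funext => n; rewrite /headpart; case: ltnP => // /hK.
by rewrite /moduli => ->; rewrite modulus0.
Qed.

Lemma c00_tbounded x : c00 x -> tbounded (moduli x).
Proof. by move=> /c00P[K /moduli_headpart ->]; exact: tbounded_headpart. Qed.

Lemma c00_restriction A x : c00 x -> c00 (coord_restriction A x).
Proof.
move=> /c00P[K hK]; apply/c00P; exists K => n /hK xn.
by rewrite /coord_restriction xn if_same.
Qed.

Lemma tnorm_mono v w : tbounded w -> (forall n, v n <= w n) -> tnorm v <= tnorm w.
Proof. by move=> bw vw; apply: tnorm_le; apply: tle_mono vw (tle_tnorm bw). Qed.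

Lemma tnorm_norm_on_c00 : norm_on_c00 (fun x => tnorm (moduli x)).
Proof.
split=> [x|x cx|a x cx|x y cx cy].
- by move=> /c00_tbounded; exact: tnorm_ge0.
- move=> x0; apply: funext => n; apply: (modulus_eq0 hF).
  apply/eqP; rewrite eq_le modulus_ge0 // andbT -x0.
  exact: (tle_coord n (tle_tnorm (c00_tbounded cx))).
- have bx := c00_tbounded cx.
  have modE : moduli (a *: x) = (fun n => modulus a * moduli x n).
    by apply: funext => n; rewrite /moduli -(modulusM hF).
  rewrite modE; have a0 := modulus_ge0 hF a.
  have hle := tleZ a0 (tle_tnorm bx).
  apply/eqP; rewrite eq_le tnorm_le //=.
  have /orP[/eqP a0'|a_gt0] : (0 == modulus a) || (0 < modulus a) by rewrite -le_eqVlt.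
    by rewrite -a0' mul0r tnorm_ge0 //; exists (0 * tnorm (moduli x)); rewrite a0'.
  rewrite -ler_pdivlMl //; apply: tnorm_le.
  have := @tleZ _ _ _ (modulus a)^-1 _ (tle_tnorm (ex_intro _ _ hle)).
  rewrite invr_ge0 ltW // => /(_ isT); apply: tle_mono => n.
  by rewrite mulKf // gt_eqF.
- apply: tnorm_le; apply: tle_mono (tleD (tle_tnorm (c00_tbounded cx))
    (tle_tnorm (c00_tbounded cy))) => n.
  exact: (modulusD hF).
Qed.

(** An empty set in the middle is related to everything by vacuity, so transitivity needs nonempty
    sets. *)
Lemma fset_lt_trans : {in [pred A : {fset nat} | A != fset0] & &, transitive fset_lt}.
Proof.
move=> B A C /fset0Pn[b bB] _ _ /allP AB /allP BC; apply/allP => a aA.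
apply/allP => c cC; apply: (@ltn_trans b).
  exact: (allP (AB a aA)).
exact: (allP (BC b bB)).
Qed.

Lemma admissible_pairwise E : admissible E ->
  all (fun A => A != fset0) E /\ pairwise fset_lt E.
Proof.
move=> [_ nE sE _]; have aE : all (fun A : {fset nat} => A != fset0) E.
  by apply/allP => A AE; apply: contraNneq nE => <-.
by split=> //; rewrite -(sorted_pairwise_in fset_lt_trans).
Qed.

(** An admissible family becomes a colouring: n is coloured by the number of sets lying entirely
    below it. On E_i this number is i, because no set is empty. *)
Lemma admissible_sum_le E x : admissible E -> c00 x ->
  \sum_(A <- E) tnorm (moduli (coord_restriction A x)) <= 2 * tnorm (moduli x).
Proof.
move=> hE cx; have [aE pE] := admissible_pairwise hE; have [_ _ _ headE] := hE.
pose kappa n := count (fun A : {fset nat} => all (fun a => a < n)%N A) E.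
have homo_k : {homo kappa : m n / (m <= n)%N}.
  move=> m n mn; apply: sub_count => A /allP h; apply/allP => a /h /leq_trans; exact.
have ltE i j a b : (i < j < size E)%N -> a \in nth fset0 E i ->
    b \in nth fset0 E j -> (a < b)%N.
  move=> /andP[ij js] aA bB.
  have /allP := (pairwiseP fset0 pE) i j (ltn_trans ij js) js ij.
  by move=> /(_ _ aA)/allP; exact.
have nzE i : (i < size E)%N -> exists a, a \in nth fset0 E i.
  by move=> lti; apply/fset0Pn; exact: (all_nthP fset0 aE).
have kappaE i n : (i < size E)%N -> n \in nth fset0 E i -> kappa n = i.
  move=> lti nA; rewrite /kappa -(cat_take_drop i E) count_cat.
  have -> : count (fun A : {fset nat} => all (fun a => a < n)%N A) (take i E) = i.
    have sz : size (take i E) = i by rewrite size_takel // ltnW.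
    rewrite -[RHS]sz; apply/eqP; rewrite -all_count; apply/(all_nthP fset0) => l.
    rewrite sz => li; rewrite nth_take //; apply/allP => a aA.
    by apply: (ltE l i) => //; rewrite li.
  rewrite (_ : count _ _ = 0)%N ?addn0 //; apply/eqP.
  rewrite -leqn0 leqNgt -has_count; apply/hasPn => A /(nthP fset0)[l].
  rewrite size_drop nth_drop => ls <-.
  case: l ls => [|l] ls; apply/negP => /allP h.
    by have := h n; rewrite addn0 nA ltnn => /(_ isT).
  have lt : (i + l.+1 < size E)%N by rewrite -ltn_subRL.
  have [a aA] := nzE _ lt.
  have := ltE i (i + l.+1)%N n a; rewrite lt nA aA -{1}(addn0 i) ltn_add2l.
  by move=> /(_ isT isT isT) /ltn_trans /(_ (h a aA)); rewrite ltnn.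
have sizeE i n : (i < size E)%N -> n \in nth fset0 E i -> (size E <= n.+1)%N.
  case: i => [|i] lti nA; first by apply: headE; rewrite -nth0.
  have lt0 : (0 < size E)%N by exact: leq_trans lti.
  have [a aA] := nzE _ lt0.
  have := headE a; rewrite -nth0 aA => /(_ isT) /leq_trans; apply.
  by rewrite ltnS ltnW //; apply: (ltE 0%N i.+1).
have bx := c00_tbounded cx.
apply: le_trans (sum_tnorm_colour (size E) (moduli_ge0 x) bx homo_k).
rewrite (big_nth fset0) big_nat [leRHS]big_nat; apply: ler_sum => i /andP[_ lti].
apply: tnorm_mono => [|n].
  exists (tnorm (moduli x)); apply: tle_mono (tle_tnorm bx) => n; case: ifP => //.
rewrite /moduli /coord_restriction; case: ifP => [nA|_].
  by rewrite (sizeE i) // (kappaE i) // eqxx.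
by rewrite modulus0 //; case: ifP => // _; exact: modulus_ge0.
Qed.

(** The converse translation. Colour classes are cut at K to be finite, and empty ones are dropped,
    which only lowers the number of sets. *)
Lemma coloured_admissible K k (kappa : nat -> nat) :
  {homo kappa : m n / (m <= n)%N} ->
  let piece i := [fset n in iota 0 K | (k <= n.+1)%N && (kappa n == i)]%fset in
  let E := [seq A <- [seq piece i | i <- iota 0 k] | A != fset0] in
  E != [::] -> admissible E.
Proof.
move=> homo_k piece E nE.
have inP i n : n \in piece i -> (k <= n.+1)%N /\ kappa n = i.
  by rewrite !inE /= => /andP[_ /andP[-> /eqP->]].
split=> //.
- by rewrite mem_filter eqxx.
- apply: pairwise_sorted; apply: pairwise_filter; rewrite pairwise_map.
  apply: (@sub_pairwise _ ltn); last first.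
    by rewrite -(sorted_pairwise ltn_trans) iota_ltn_sorted.
  move=> i j /= ij; apply/allP => a /inP[_ ai]; apply/allP => b /inP[_ bj].
  by rewrite ltnNge; apply/negP => /homo_k; rewrite ai bj leqNgt ij.
- move=> n; have : head fset0 E \in E by case: (E) nE => // A s _; rewrite mem_head.
  rewrite mem_filter => /andP[_ /mapP[i _ ->]] /inP[lek _].
  apply: leq_trans lek.
  by rewrite size_filter (leq_trans (count_size _ _)) // size_map size_iota.
Qed.

Lemma ubound_moduli x : c00 x -> has_ubound [set modulus (x n) | n in [set: nat]].
Proof.
move=> cx; exists (tnorm (moduli x)) => _ [n _ <-].
exact: (tle_coord n (tle_tnorm (c00_tbounded cx))).
Qed.

Lemma sup_moduli_ge x n : c00 x -> modulus (x n) <= sup [set modulus (x n) | n in [set: nat]].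
Proof. by move=> cx; apply: ub_le_sup; [exact: ubound_moduli | exists n]. Qed.

Lemma admissible_nonempty : admissible !=set0.
Proof.
exists [:: [fset 0%N]%fset]; split=> //.
by rewrite inE; apply/eqP => /fsetP/(_ 0%N); rewrite !inE.
Qed.

Lemma tnorm_equation : tsirelson_equation (fun x => tnorm (moduli x)).
Proof.
move=> x cx; set s1 := sup _; set s2 := sup _.
have bx := c00_tbounded cx.
have ub2 : has_ubound [set \sum_(A <- E) tnorm (moduli (coord_restriction A x)) | E in admissible].
  by exists (2 * tnorm (moduli x)) => _ [E hE <-]; exact: admissible_sum_le.
have s1_ge0 : 0 <= s1 by apply: le_trans (sup_moduli_ge 0 cx); exact: modulus_ge0.
apply/eqP; rewrite eq_le; apply/andP; split; last first.
  rewrite ge_max; apply/andP; split.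
    apply: ge_sup; first by exists (modulus (x 0%N)), 0%N.
    by move=> _ [n _ <-]; exact: (tle_coord n (tle_tnorm bx)).
  rewrite ler_pdivrMl //; apply: ge_sup.
    by have [E hE] := admissible_nonempty; eexists; exists E.
  by move=> _ [E hE <-]; exact: admissible_sum_le.
apply: tnorm_le => phi hphi N; rewrite le_max.
case: hphi => [m|k kappa phis homo_k hphis].
  apply/orP; left; have [lt|ge] := ltnP m N; last first.
    rewrite big_nat big1 // => n /andP[_ ltn].
    by rewrite (ltn_eqF (leq_trans ltn ge)) mul0r.
  rewrite (bigD1_seq m) ?mem_index_iota ?iota_uniq //= eqxx mul1r.
  rewrite big1 ?addr0; first exact: sup_moduli_ge.
  by move=> n /negbTE ->; rewrite mul0r.
have /c00P[K hK] := cx.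
pose piece i := [fset n in iota 0 (maxn N K) | (k <= n.+1)%N && (kappa n == i)]%fset.
pose E := [seq A <- [seq piece i | i <- iota 0 k] | A != fset0].
have le_sum : \sum_(0 <= n < N) (if (k <= n.+1)%N && (kappa n < k)%N
      then 2^-1 * phis (kappa n) n else 0) * moduli x n <=
    2^-1 * \sum_(A <- E) tnorm (moduli (coord_restriction A x)).
  have idx : iota 0 k = index_iota 0 k by rewrite /index_iota subn0.
  rewrite big_filter big_map idx.
  have -> : \sum_(0 <= i < k | piece i != fset0)
      tnorm (moduli (coord_restriction (piece i) x)) =
      \sum_(0 <= i < k) tnorm (moduli (coord_restriction (piece i) x)).
    rewrite [RHS](bigID (fun i => piece i != fset0)) /= [X in _ + X]big1 ?addr0 //.
    move=> i /negPn/eqP->; apply/eqP; rewrite eq_le tnorm_ge0 ?andbT; last first.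
      exact/c00_tbounded/c00_restriction.
    apply: tnorm_le => phi0 _ l; rewrite big1 // => n _.
    by rewrite /moduli /coord_restriction inE modulus0 // mulr0.
  rewrite -ler_pdivrMl ?invr_gt0 // invrK mulr_sumr.
  apply: (@le_trans _ _ (\sum_(0 <= i < k) \sum_(0 <= n < N)
      phis i n * moduli (coord_restriction (piece i) x) n)); last first.
    rewrite big_nat [leRHS]big_nat; apply: ler_sum => i _.
    exact: (tle_tnorm (c00_tbounded (c00_restriction _ cx)) (hphis i)).
  rewrite exchange_big /= big_nat [leRHS]big_nat; apply: ler_sum => n /andP[_ ltnN].
  have terms0 i : 0 <= phis i n * moduli (coord_restriction (piece i) x) n.
    by apply: mulr_ge0 => //; exact: norming_ge0.
  case: ifP => [/andP[lek ltk]|_]; last by rewrite mul0r mulr0 sumr_ge0.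
  rewrite (bigD1_seq (kappa n)) ?mem_index_iota ?iota_uniq //=.
  rewrite /moduli {1}/coord_restriction !inE /= mem_iota lek eqxx.
  rewrite add0n leq_max ltnN /= ?andbT mulrA mulrA divff // mul1r lerDl.
  exact: sumr_ge0.
(* If all pieces are empty there is no admissible family to use, but the functional is then at most
   0 on x and the supremum norm bounds it. *)
have [E0|nE] := eqVneq E [::].
  rewrite E0 big_nil mulr0 in le_sum.
  by rewrite (le_trans le_sum).
apply/orP; right; apply: le_trans le_sum _; rewrite ler_pM2l ?invr_gt0 //.
apply: ub_le_sup => //; exists E => //.
exact: coloured_admissible.
Qed.

Lemma norm_on_c00_0 (N : sequences F -> R) : norm_on_c00 N -> N 0 = 0.
Proof.
move=> [_ _ NZ _]; rewrite -[0 in LHS](scale0r (0 : sequences F)) NZ ?modulus0 ?mul0r //.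
by apply/c00P; exists 0%N.
Qed.

(** Uniqueness of the norm, by induction on the size of the support. If every set of an admissible
    family misses a point of the support, the induction hypothesis applies to each piece. Otherwise
    one set contains the support, the others miss it, and the sum is N1 x, harmless because of the
    factor 1/2. The sums for N2 have to be bounded since [sup] of an unbounded set is a default
    value. *)
Lemma tsirelson_equation_le (N1 N2 : sequences F -> R) :
  norm_on_c00 N1 -> norm_on_c00 N2 ->
  tsirelson_equation N1 -> tsirelson_equation N2 ->
  (forall x, c00 x -> has_ubound
     [set \sum_(A <- E) N2 (coord_restriction A x) | E in admissible]) ->
  forall x, c00 x -> N1 x <= N2 x.
Proof.
move=> nN1 nN2 eq1 eq2 ub2 x /c00P[K].
have [m] := ubnP (count (fun n => x n != 0) (iota 0 K)).
elim: m x => // m IH x ltm hK.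
have cx : c00 x by apply/c00P; exists K.
have [ge1 _ _ _] := nN1; have [ge2 _ _ _] := nN2.
have le_sup1 : sup [set modulus (x n) | n in [set: nat]] <= N2 x.
  by rewrite (eq2 _ cx) le_max lexx.
have le_sup2 : sup [set \sum_(A <- E) N2 (coord_restriction A x) | E in admissible] <=
    2 * N2 x.
  by rewrite -ler_pdivrMl // [leRHS](eq2 _ cx) le_max lexx orbT.
suff : N1 x <= Num.max (N2 x) (2^-1 * Num.max (2 * N2 x) (N1 x)).
  have := ge1 x cx; have := ge2 x cx.
  by case: (leP (2 * N2 x) (N1 x)) => _ ? ?; rewrite le_max => /orP[]; lra.
rewrite {1}(eq1 _ cx) ge_max !le_max le_sup1 /=; apply/orP; right.
rewrite ler_pM2l ?invr_gt0 //; apply: ge_sup.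
  by have [E hE] := admissible_nonempty; eexists; exists E.
move=> _ [E hE <-]; rewrite le_max.
have [aE pE] := admissible_pairwise hE.
have [/hasP[A AE full]|/hasPn small] :=
    boolP (has (fun A : {fset nat} => all (fun n => (x n != 0) ==> (n \in A)) (iota 0 K)) E).
  apply/orP; right; move: aE pE; case/splitPr: AE => E1 E2.
  rewrite all_cat /= pairwise_cat /= => _ /and3P[/allrelP E1A _ /andP[/allP AE2 _]].
  have inA n : x n != 0 -> n \in A.
    move=> nz; have ltn : (n < K)%N.
      by rewrite ltnNge; apply/negP => /hK xn; rewrite xn eqxx in nz.
    by move/allP: full => /(_ n); rewrite mem_iota ltn nz => /(_ isT).
  rewrite big_cat big_cons /= [X in X + _]big1_seq ?[X in _ + (_ + X)]big1_seq.
  - rewrite add0r addr0 (_ : coord_restriction A x = x) //.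
    apply: funext => n; rewrite /coord_restriction; case: ifPn => // nA.
    by apply/esym/eqP; apply: contraR nA => /inA.
  - move=> B /= BE2; rewrite (_ : coord_restriction B x = 0) ?norm_on_c00_0 //.
    apply: funext => n; rewrite /coord_restriction; case: ifP => // nB.
    apply/eqP; apply: contraT => /inA nA.
    by have /allP/(_ n nA)/allP/(_ n nB) := AE2 B BE2; rewrite ltnn.
  - move=> B /= BE1; rewrite (_ : coord_restriction B x = 0) ?norm_on_c00_0 //.
    apply: funext => n; rewrite /coord_restriction; case: ifP => // nB.
    apply/eqP; apply: contraT => /inA nA.
    have /allP/(_ n nB)/allP/(_ n nA) := E1A B A BE1 (mem_head _ _).
    by rewrite ltnn.
apply/orP; left; apply: le_trans le_sup2.
apply: (@le_trans _ _ (\sum_(A <- E) N2 (coord_restriction A x))); last first.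
  by apply: ub_le_sup; [exact: ub2 | exists E].
rewrite big_seq [leRHS]big_seq; apply: ler_sum => A /small.
rewrite -has_predC => /hasP[n0 n0K]; rewrite /= negb_imply => /andP[nz nA].
apply: IH => [|n /hK xn]; last by rewrite /coord_restriction xn if_same.
apply: leq_trans (ltm : (_ <= m)%N).
rewrite -!size_filter; apply: (@leq_ltn_trans (size (seq.filter (predC1 n0) [seq n <- iota 0 K | x n != 0]))).
  rewrite -filter_predI !size_filter; apply: sub_count => n /=.
  rewrite /coord_restriction; case: ifP => [nA' ->|]; last by rewrite eqxx.
  by rewrite andbT; apply: contraNneq nA => <-.
rewrite size_filter -(count_predC (pred1 n0) [seq n <- iota 0 K | x n != 0]).
rewrite -[X in (X < _)%N]add0n ltn_add2r -has_count has_pred1.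
by rewrite mem_filter nz.
Qed.

Lemma tsirelson_normE x : c00 x -> tsirelson_norm x = tnorm (moduli x).
Proof.
move=> cx; have [nT eqT] : norm_on_c00 (@tsirelson_norm R F) /\
    tsirelson_equation (@tsirelson_norm R F).
  apply: (@xgetPex _ (fun=> 0) [set N | norm_on_c00 N /\ tsirelson_equation N]).
  exists (fun x => tnorm (moduli x)).
  by split; [exact: tnorm_norm_on_c00 | exact: tnorm_equation].
have ubt y : c00 y -> has_ubound
    [set \sum_(A <- E) tnorm (moduli (coord_restriction A y)) | E in admissible].
  by move=> cy; exists (2 * tnorm (moduli y)) => _ [E hE <-]; exact: admissible_sum_le.
have le1 := tsirelson_equation_le nT tnorm_norm_on_c00 eqT tnorm_equation ubt.
apply/eqP; rewrite eq_le le1 //=.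
(* The inequality just obtained supplies the upper bound that the reverse one requires. *)
apply: (tsirelson_equation_le tnorm_norm_on_c00 nT tnorm_equation eqT) => // y cy.
exists (2 * tnorm (moduli y)) => _ [E hE <-].
apply: le_trans (admissible_sum_le hE cy); apply: ler_sum => A _.
exact/le1/c00_restriction.
Qed.

(** Differences of truncations are finite pieces of a tail, and they determine its norm as a
    supremum; [tle] is used because the tail need not be finitely supported. *)
Lemma tsirelson_spaceP x : tsirelson_space x <->
  forall e, 0 < e -> exists K, tle (tailpart K (moduli x)) e.
Proof.
have ctrunc n : c00 (truncation n x).
  by apply/c00P; exists n => i le; rewrite /truncation ltnNge le.
have cdiff m n : c00 (truncation m x - truncation n x).
  apply/c00P; exists (maxn m n) => i; rewrite geq_max => /andP[lem len].
  by rewrite seqBE /truncation !ltnNge lem len subr0.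
have diff_le m n i : (m <= n)%N ->
    moduli (truncation n x - truncation m x) i = headpart n (tailpart m (moduli x)) i.
  move=> mn; rewrite /moduli seqBE /truncation /headpart /tailpart.
  have [lt|ge] := ltnP i m; first by rewrite (leq_trans lt mn) subrr modulus0.
  by rewrite subr0; case: ifP => // _; rewrite modulus0.
split=> [hx e e0|hx e e0].
  have [K hK] := hx e e0; exists K; apply: tle_headpart => N.
  have [le|lt] := leqP K N.
    have := hK N K le (leqnn K); rewrite tsirelson_normE // => /ltW lee.
    apply: tle_weaken lee _; apply: tle_mono (tle_tnorm (c00_tbounded (cdiff N K))).
    by move=> i; rewrite diff_le.
  apply: tle_weaken (ltW e0) _; apply: tle_l1 => [n|l].
    by rewrite /headpart /tailpart; do 2 case: ifP => // _.
  rewrite big1 // => n _; rewrite /headpart /tailpart.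
  by case: ltnP => // ltnN; rewrite leqNgt (ltn_trans ltnN lt).
have e20 : 0 < e / 2 by rewrite divr_gt0.
have [K hK] := hx _ e20; exists K => m n.
wlog mn : m n / (m <= n)%N.
  move=> wl Km Kn; have [mn|/ltnW nm] := leqP m n; first exact: wl.
  rewrite -opprB tsirelson_normE; last by rewrite opprB; exact: cdiff.
  rewrite (@tnorm_ext _ _ (moduli (truncation n x - truncation m x))).
    by rewrite -tsirelson_normE //; exact: wl.
  by move=> i; rewrite {1}/moduli seqNE modulusN.
move=> Km Kn; rewrite -opprB tsirelson_normE; last by rewrite opprB; exact: cdiff.
apply: (@le_lt_trans _ _ (e / 2)); last by rewrite ltr_pdivrMr // ltr_pMr // ltr1n.
apply: tnorm_le; apply: tle_mono hK => i.
rewrite /moduli seqNE modulusN // -/(moduli _ i) diff_le //.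
apply: (@le_trans _ _ (tailpart m (moduli x) i)).
  by apply: headpart_le; rewrite /tailpart; case: ifP.
rewrite /tailpart; case: leqP => [mi|_]; first by rewrite (leq_trans Km mi).
by case: ifP => // _; exact: modulus_ge0.
Qed.

Lemma tsirelson_space_tbounded x : tsirelson_space x -> tbounded (moduli x).
Proof.
move=> /tsirelson_spaceP/(_ 1 ltr01)[K hK].
have [C hC] := tbounded_headpart K (moduli_ge0 x).
exists (C + 1); apply: tle_mono (tleD hC hK) => n.
by rewrite /headpart /tailpart ltnNge; case: leqP; rewrite /= ?addr0 ?add0r.
Qed.

Lemma tsirelson_space_normE x : tsirelson_space x ->
  tsirelson_space_norm x = tnorm (moduli x).
Proof.
move=> hx; have bx := tsirelson_space_tbounded hx.
have truncE n : moduli (truncation n x) = headpart n (moduli x).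
  apply: funext => i; rewrite /moduli /truncation /headpart.
  by case: ifP => // _; rewrite modulus0.
have normE n : tsirelson_norm (truncation n x) = tnorm (headpart n (moduli x)).
  rewrite tsirelson_normE ?truncE //.
  by apply/c00P; exists n => i le; rewrite /truncation ltnNge le.
rewrite /tsirelson_space_norm; under eq_fun do rewrite normE.
have le_n n : tnorm (headpart n (moduli x)) <= tnorm (moduli x).
  by apply: tnorm_mono => // i; exact: headpart_le.
have ub : has_ubound (range (fun n => tnorm (headpart n (moduli x)))).
  by exists (tnorm (moduli x)) => _ [n _ <-].
have mono : {homo (fun n => tnorm (headpart n (moduli x))) : m n / (m <= n)%N >-> m <= n}.
  move=> m n mn; apply: tnorm_mono; first exact: tbounded_headpart.
  move=> i; rewrite /headpart; case: ltnP => [lt|_]; first by rewrite (leq_trans lt).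
  by case: ifP.
rewrite (cvg_lim _ (nondecreasing_cvgn mono ub)) //.
apply/eqP; rewrite eq_le; apply/andP; split.
  by apply: ge_sup; [exists (tnorm (headpart 0 (moduli x))), 0%N | move=> _ [n _ <-]].
apply: tnorm_le; apply: tle_headpart => n.
apply: (@tle_weaken _ _ (tnorm (headpart n (moduli x)))).
  by apply: ub_le_sup => //; exists n.
by apply: tle_tnorm; exact: tbounded_headpart.
Qed.

End TsirelsonNorm.

(** * Heaps *)

(* The nodes of a heap are 0 .. m-1; the parent of i > 0 is i.-1 %/ b. *)
Section Heap.
Variable R : realType.
Implicit Types (h v D g : nat -> R) (b m r : nat) (s : R) (P : pred nat).

Lemma sum_divn h b m : (0 < b)%N ->
  \sum_(0 <= i < b * m) h (i %/ b)%N = b%:R * \sum_(0 <= q < m) h q.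
Proof.
move=> b0; elim: m => [|m IH]; first by rewrite muln0 !big_geq ?mulr0.
rewrite mulnS addnC (big_cat_nat (leq0n _) (leq_addr _ _)) /= IH.
rewrite big_nat_recr //= mulrDr; congr (_ + _).
rewrite -{1}[(b * m)%N]add0n big_addn addKn.
rewrite (eq_big_nat _ _ (F2 := fun=> h m)).
  by rewrite sumr_const_nat subn0 mulr_natl.
by move=> i /andP[_ ltib]; rewrite addnC mulnC divnMDl // divn_small // addn0.
Qed.

(** A node q has at most the b children bq + 1, ..., bq + b. *)
Lemma sum_parents_le h b m : (0 < b)%N -> (forall i, 0 <= h i) ->
  \sum_(1 <= i < m) h (i.-1 %/ b)%N <= b%:R * \sum_(0 <= q < m) h q.
Proof.
move=> b0 h0; rewrite -sum_divn //; case: m => [|m].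
  by rewrite big_geq // sumr_ge0.
rewrite big_add1 /=; have le : (m <= b * m.+1)%N by nia.
by rewrite [leRHS](big_cat_nat (leq0n m) le) /= lerDl sumr_ge0.
Qed.

Definition pos s : R := Num.max s 0.

Section Potential.
Variables (b m : nat) (v D : nat -> R).
Hypotheses (b_gt1 : (1 < b)%N) (v_ge0 : forall i, 0 <= v i) (D_ge0 : forall i, 0 <= D i).
Hypothesis v_root : v 0%N <= D 0%N.
Hypothesis v_child : forall i, (0 < i < m)%N -> v i <= v (i.-1 %/ b)%N / b%:R + D i.
Let V := \sum_(0 <= i < m) D i.

Let b_gt0 : 0 < b%:R :> R. Proof. by rewrite ltr0n ltnW. Qed.
Let b_ge2 : 2 <= b%:R :> R. Proof. by rewrite ler_nat. Qed.
Let V_ge0 : 0 <= V. Proof. exact: sumr_ge0. Qed.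
Let bV_le : b%:R^-1 <= 2^-1 :> R.
Proof. by rewrite lef_pV2 ?posrE. Qed.

Lemma pos_ge0 s : 0 <= pos s. Proof. by rewrite le_max lexx orbT. Qed.

(* The excess of v over s, transported from the parents, is the potential. *)
Lemma heap_level s : 0 <= s ->
  \sum_(0 <= i < m) (pos (v i - s / b%:R) - pos (v i - s)) <= V.
Proof.
move=> s0; rewrite sumrB lerBlDr.
case: (posnP m) => [m0|m0]; first by rewrite /V m0 !big_geq // addr0.
rewrite /V big_ltn // [X in _ <= X + _]big_ltn // -addrA.
apply: (@le_trans _ _ (D 0%N + \sum_(1 <= i < m) (D i + pos (v (i.-1 %/ b)%N - s) / b%:R))).
  apply: lerD.
    rewrite /pos ge_max D_ge0 andbT; apply: le_trans v_root.
    by rewrite gerBl divr_ge0 // ltW.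
  rewrite big_nat [leRHS]big_nat; apply: ler_sum => i im.
  rewrite /pos ge_max; have p0 := pos_ge0 (v (i.-1 %/ b)%N - s).
  rewrite addr_ge0 ?andbT // ?divr_ge0 // ?(ltW b_gt0) //.
  have : (v (i.-1 %/ b)%N - s) / b%:R <= pos (v (i.-1 %/ b)%N - s) / b%:R.
    by rewrite ler_pM2r ?invr_gt0 // le_max lexx.
  rewrite mulrBl; have := v_child im; rewrite -/(pos _); lra.
rewrite big_split /= !lerD2l -mulr_suml ler_pdivrMr // mulrC.
by apply: (sum_parents_le (h := fun q => pos (v q - s))) => [|i]; rewrite ?pos_ge0 // ltnW.
Qed.

(** [heap_level] at s, s/b, ..., s/b^(r-1); the positive parts telescope. *)
Lemma heap_levels s r : 0 <= s ->
  \sum_(0 <= i < m) (pos (v i - s / b%:R ^+ r) - pos (v i - s)) <= r%:R * V.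
Proof.
move=> s0; elim: r => [|r IH].
  by rewrite expr0 divr1 mul0r big1 // => i _; rewrite subrr.
have s1 : 0 <= s / b%:R ^+ r by rewrite divr_ge0 // exprn_ge0 // ltW.
have := heap_level s1; rewrite -mulrA -invfM -exprSr => le1.
rewrite -natr1 mulrDl mul1r; apply: le_trans (lerD IH le1).
by rewrite -big_split /=; apply: ler_sum => i _; lra.
Qed.

Lemma pos_level s t : 0 <= s -> 0 <= pos (t - s / b%:R) - pos (t - s).
Proof.
move=> s0; rewrite subr_ge0 /pos ge_max pos_ge0 andbT le_max lerD2l lerN2.
by rewrite ler_pdivrMr // ler_peMr // (le_trans _ b_ge2) // ler1n.
Qed.

(** A node with v_i >= s contributes s - s/b >= s/2 to the layer of [heap_level], and no node
    contributes negatively. *)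
Lemma heap_card s P : 0 <= s -> (forall i, (i < m)%N -> P i -> s <= v i) ->
  \sum_(0 <= i < m | P i) s <= 2 * V.
Proof.
move=> s0 hP; rewrite -ler_pdivrMl // mulr_sumr; apply: le_trans (heap_level s0).
rewrite [leRHS](bigID P) /= -[leLHS]addr0 lerD ?sumr_ge0 // => [|i _]; last exact: pos_level.
rewrite big_nat_cond [leRHS]big_nat_cond; apply: ler_sum => i /andP[/andP[_ im] /(hP _ im) le].
have : s / b%:R <= s * 2^-1 by apply: ler_wpM2l.
rewrite /pos [Num.max (_ - s / _) _]max_l; last first.
  by rewrite subr_ge0 (le_trans _ le) // ler_pdivrMr // ler_peMr // (le_trans _ b_ge2) // ler1n.
by rewrite max_l ?subr_ge0 //; lra.
Qed.

Lemma heap_sup i : (i < m)%N -> v i <= 2 * V.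
Proof.
move=> im; have := @heap_card (v i) (pred1 i) (v_ge0 i).
rewrite -big_filter filter_pred1_uniq ?iota_uniq ?mem_index_iota // big_seq1.
by apply => k _ /eqP->.
Qed.

(** The layers start at s = 2V, above all weights by [heap_sup], and go down r levels at a cost of V
    each. Below s/b^r there remains at most s/b^r for each of at most b^r nodes, hence 2V in all. *)
Lemma heap_top r P : (count P (iota 0 m) <= b ^ r)%N ->
  \sum_(0 <= i < m | P i) v i <= (2 + r%:R) * V.
Proof.
move=> cP; pose s := 2 * V; have s0 : 0 <= s by rewrite mulr_ge0.
have br : 0 < b%:R ^+ r :> R by rewrite exprn_gt0.
apply: (@le_trans _ _ (\sum_(0 <= i < m | P i) (s / b%:R ^+ r) +
    \sum_(0 <= i < m) (pos (v i - s / b%:R ^+ r) - pos (v i - s)))).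
  rewrite [X in _ + X](bigID P) /= addrA -big_split /= -[leLHS]addr0 lerD //.
    rewrite big_nat_cond [leRHS]big_nat_cond; apply: ler_sum => i /andP[/andP[_ im] _].
    rewrite [pos (v i - s)]max_r ?subr_le0 ?heap_sup // subr0 addrC -lerBlDr.
    by rewrite le_max lexx.
  rewrite big_nat_cond sumr_ge0 // => i /andP[/andP[_ im] _].
  by rewrite [pos (v i - s)]max_r ?subr_le0 ?heap_sup // subr0 pos_ge0.
rewrite mulrDl lerD ?heap_levels // big_const_seq iter_addr_0 /index_iota subn0.
rewrite -/s -[leLHS]mulr_natl mulrA ler_pdivrMr // mulrC ler_wpM2l //.
by rewrite -natrX ler_nat.
Qed.

(* A boundary edge with the child outside P and the parent q in P is harmful
   only if s <= v q <= 2 b s, which costs at most three levels. *)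
Lemma heap_greedy P s g : 0 <= s ->
  (forall i, (i < m)%N -> P i -> s <= v i) ->
  (forall i, (i < m)%N -> ~~ P i -> v i <= s) ->
  (forall i, (0 < i < m)%N -> v (i.-1 %/ b)%N / b%:R <= v i + D i) ->
  g 0%N <= v 0%N ->
  (forall i, (0 < i < m)%N -> let q := (i.-1 %/ b)%N in
     g i <= if P i then (if P q then D i else v i) else (if P q then v q / b%:R else 0)) ->
  \sum_(0 <= i < m) g i <= 8 * V.
Proof.
move=> s0 sP sN vD g0 gP.
case: (posnP m) => [m0|m0]; first by rewrite /V m0 !big_geq // mulr0.
(* The part of t in the three levels from s/b up to b^2 s, which cover s <= t <= 2bs as b >= 2. *)
pose Psi t := pos (t - b%:R ^+ 2 * s / b%:R ^+ 3) - pos (t - b%:R ^+ 2 * s).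
have sE : b%:R ^+ 2 * s / b%:R ^+ 3 = s / b%:R.
  by have := b_gt0; move=> ?; field; rewrite gt_eqF.
have s_le : s / b%:R <= s * 2^-1 by apply: ler_wpM2l.
have b2s : s <= b%:R ^+ 2 * s.
  by rewrite ler_peMl // exprn_ege1 // (le_trans _ b_ge2) // ler1n.
have Psi_ge0 t : 0 <= Psi t.
  rewrite /Psi sE subr_ge0 /pos ge_max pos_ge0 andbT le_max lerD2l lerN2.
  by apply/orP; left; lra.
have lePsi : \sum_(0 <= i < m) Psi (v i) <= 3 * V.
  by apply: heap_levels; rewrite mulr_ge0 // exprn_ge0 // ltW.
have gle i : (0 < i < m)%N -> g i <= 2 * D i + (2 * Psi (v (i.-1 %/ b)%N)) / b%:R.
  move=> im; have := gP i im; set q := (i.-1 %/ b)%N => /= gi.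
  have {}im' : (i < m)%N by case/andP: im.
  have qm : (q < m)%N by apply: leq_ltn_trans im'; rewrite (leq_trans (leq_div _ _)) // leq_pred.
  have Di := D_ge0 i; have vc := v_child im; rewrite -/q in vc.
  have Pq : 0 <= 2 * Psi (v q) / b%:R by rewrite divr_ge0 ?mulr_ge0 // ltW.
  have := vD i im; rewrite -/q => vd.
  move: gi; case: ifPn => [Pi|nPi]; case: ifPn => [PPq|nPq] gi; [lra| |  |lra].
    (* Child in P, parent outside: v_q/b <= s/2 <= v_i/2, so D_i is at least half of v_i. *)
    have := sP i im' Pi; have := sN q qm nPq => le1 le2.
    have : v q / b%:R <= s / b%:R by rewrite ler_pM2r ?invr_gt0.
    lra.
  have le1 := sP q qm PPq; have le2 := sN i im' nPi.
  (* If v_i is below half of v_q/b, then D_i is at least the other half; otherwise v_q <= 2b v_i <=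
     2bs and the three levels pay. *)
  have [small|big] := leP (v i) (v q / b%:R / 2); first by lra.
  have vq_le : v q <= b%:R ^+ 2 * s.
    have : v q <= 2 * s * b%:R by rewrite -ler_pdivrMr //; lra.
    move=> h; apply: le_trans h _; rewrite expr2 -mulrA [s * _]mulrC mulrA ler_wpM2r //.
    by rewrite ler_pM2r.
  have : v q <= 2 * Psi (v q).
    rewrite /Psi sE [pos (_ - b%:R ^+ 2 * s)]max_r ?subr_le0 // subr0.
    have : v q - s / b%:R <= pos (v q - s / b%:R) by rewrite le_max lexx.
    lra.
  rewrite -(ler_pM2r (x := b%:R^-1)) ?invr_gt0 //; lra.
apply: (@le_trans _ _ (D 0%N + \sum_(1 <= i < m) (2 * D i + (2 * Psi (v (i.-1 %/ b)%N)) / b%:R))).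
  rewrite [leLHS]big_ltn //; apply: lerD; first exact: le_trans v_root.
  by rewrite big_nat [leRHS]big_nat; apply: ler_sum => i; exact: gle.
rewrite big_split /= -mulr_sumr -mulr_suml.
have : (\sum_(1 <= i < m) 2 * Psi (v (i.-1 %/ b)%N)) / b%:R <= 6 * V.
  rewrite ler_pdivrMr // mulrC -mulr_sumr.
  have le := @sum_parents_le (fun q => Psi (v q)) b m (ltnW b_gt1) (fun i => Psi_ge0 _).
  rewrite mulrC; apply: (@le_trans _ _ (2 * (b%:R * (3 * V)))); last by lra.
  rewrite ler_pM2l //; apply: le_trans le _; rewrite ler_pM2l //.
have S0 : 0 <= \sum_(1 <= i < m) D i by exact: sumr_ge0.
have VE : V = D 0%N + \sum_(1 <= i < m) D i by rewrite /V big_ltn.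
have := D_ge0 0%N; rewrite VE; lra.
Qed.

End Potential.

End Heap.

(** * The tree basis *)

Lemma powR_subadditive (R : realType) (p x y : R) : 0 < p -> p <= 1 ->
  0 <= x -> 0 <= y -> (x + y) `^ p <= x `^ p + y `^ p.
Proof.
move=> p0 p1 x0 y0; have [->|xnz] := eqVneq x 0.
  by rewrite powR0 ?gt_eqF // !add0r.
have [->|ynz] := eqVneq y 0; first by rewrite powR0 ?gt_eqF // !addr0.
have xgt : 0 < x by rewrite lt_def xnz.
have ygt : 0 < y by rewrite lt_def ynz.
pose z := x + y; have zgt : 0 < z by rewrite addr_gt0.
have frac t : 0 < t -> t <= z -> t / z * z `^ p <= t `^ p.
  move=> t0 tz; have t1 : 0 < t / z <= 1.
    by rewrite divr_gt0 //= ler_pdivrMr // mul1r.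
  have -> : t `^ p = (t / z) `^ p * z `^ p.
    by rewrite -powRM ?(ltW zgt) ?divr_ge0 ?(ltW t0) ?(ltW zgt) // divfK // gt_eqF.
  by rewrite ler_wpM2r ?powR_ge0 // ger1_powR.
have -> : (x + y) `^ p = x / z * z `^ p + y / z * z `^ p.
  by rewrite -mulrDl -mulrDl -/z divff ?mul1r // gt_eqF.
by apply: lerD; apply: frac => //; rewrite /z ?lerDl ?lerDr // ltW.
Qed.

(** * The p-convexified space in terms of p-th powers *)

Section Space.
Variables (R : realType) (F : scalar_field R) (p : R).
Hypotheses (hF : good_scalars F) (p_gt0 : 0 < p) (p_le1 : p <= 1).
Implicit Types (f g : sequences F) (C : R).

Let X : qspace F := convexified_tsirelson F p.

Definition mpow (a : F) : R := modulus a `^ p.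
Definition pw f : nat -> R := fun n => mpow (f n).

Lemma mpow_ge0 a : 0 <= mpow a. Proof. exact: powR_ge0. Qed.
Lemma pw_ge0 f n : 0 <= pw f n. Proof. exact: mpow_ge0. Qed.

Lemma mpowM a b : mpow (a * b) = mpow a * mpow b.
Proof. by rewrite /mpow (modulusM hF) powRM // modulus_ge0. Qed.

Lemma mpow0 : mpow 0 = 0.
Proof. by rewrite /mpow modulus0 // powR0 // gt_eqF. Qed.

Lemma mpow1 : mpow 1 = 1.
Proof. by rewrite /mpow modulus1 // powR1. Qed.

Lemma mpowN a : mpow (- a) = mpow a.
Proof. by rewrite /mpow modulusN. Qed.

Lemma mpow_le a b : (mpow a <= mpow b) = (modulus a <= modulus b).
Proof.
have ge0 (c : F) : modulus c \is Num.nneg by rewrite nnegrE modulus_ge0.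
apply/idP/idP; last by apply: ge0_ler_powR => //; exact: ltW.
apply: contraTT; rewrite -!ltNge; apply: gt0_ltr_powR => //.
Qed.

Lemma mpowD a b : mpow (a + b) <= mpow a + mpow b.
Proof.
apply: le_trans (powR_subadditive p_gt0 p_le1 (modulus_ge0 hF a) (modulus_ge0 hF b)).
apply: ge0_ler_powR; rewrite ?nnegrE ?addr_ge0 ?modulus_ge0 ?(ltW p_gt0) //.
exact: (modulusD hF).
Qed.

Lemma mpowB a b : mpow (a - b) <= mpow a + mpow b.
Proof. by rewrite -(mpowN b) mpowD. Qed.

Lemma moduli_abs_power f : moduli (abs_power p f) = pw f.
Proof.
apply: funext => n; rewrite /moduli /abs_power (modulus_real hF) ger0_norm //.
exact: powR_ge0.
Qed.

Lemma pointsP f : points X f <-> forall e, 0 < e -> exists K, tle (tailpart K (pw f)) e.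
Proof. by rewrite -moduli_abs_power; exact: tsirelson_spaceP. Qed.

Lemma points_tbounded f : points X f -> tbounded (pw f).
Proof. by move=> /(tsirelson_space_tbounded hF); rewrite moduli_abs_power. Qed.

Lemma qnormE f : points X f -> qnorm (f : ambient X) = tnorm (pw f) `^ p^-1.
Proof. by move=> /(tsirelson_space_normE hF) /= ->; rewrite moduli_abs_power. Qed.

Lemma powRVK C : 0 <= C -> (C `^ p^-1) `^ p = C.
Proof. by move=> C0; rewrite -powRrM mulVf ?powRr1 // gt_eqF. Qed.

Lemma powRKV C : 0 <= C -> (C `^ p) `^ p^-1 = C.
Proof. by move=> C0; rewrite -powRrM divff ?powRr1 // gt_eqF. Qed.

Lemma ler_powRV C D : 0 <= C -> C <= D -> C `^ p^-1 <= D `^ p^-1.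
Proof.
move=> C0 CD; apply: ge0_ler_powR; rewrite ?nnegrE ?invr_ge0 ?(ltW p_gt0) //.
exact: le_trans CD.
Qed.

Lemma qnorm_ge0 f : points X f -> 0 <= qnorm (f : ambient X).
Proof. by move=> /qnormE ->; exact: powR_ge0. Qed.

Lemma qnorm_le f C : points X f -> tle (pw f) C -> qnorm (f : ambient X) <= C `^ p^-1.
Proof.
move=> hf le; rewrite qnormE //; apply: ler_powRV; last exact: tnorm_le.
exact/tnorm_ge0/points_tbounded.
Qed.

Lemma tle_qnorm f : points X f -> tle (pw f) (qnorm (f : ambient X) `^ p).
Proof.
move=> hf; have bf := points_tbounded hf.
by rewrite qnormE // powRVK ?tnorm_ge0 //; exact: tle_tnorm.
Qed.

Lemma pwD f g n : pw (f + g) n <= pw f n + pw g n. Proof. exact: mpowD. Qed.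

Lemma pwZ a f n : pw (a *: f) n = mpow a * pw f n. Proof. exact: mpowM. Qed.

Lemma points_finite f K : (forall n, (K <= n)%N -> f n = 0) -> points X f.
Proof.
move=> hK; apply/pointsP => e e0; exists K; apply: tle_weaken (ltW e0) _.
apply: tle_l1 => [n|N]; rewrite /tailpart; first by case: ifP => // _; exact: pw_ge0.
by rewrite big1 // => n _; case: ifP => // /hK; rewrite /pw => ->; exact: mpow0.
Qed.

Lemma pointsD f g : points X f -> points X g -> points X (f + g).
Proof.
move=> /pointsP hf /pointsP hg; apply/pointsP => e e0.
have e20 : 0 < e / 2 by rewrite divr_gt0.
have [K hK] := hf _ e20; have [L hL] := hg _ e20; exists (maxn K L).
rewrite [e]splitr; apply: tle_mono (tleD hK hL) => n; rewrite /tailpart geq_max.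
case: leqP => [_|_] /=; case: leqP => _ /=; rewrite ?addr_ge0 ?pw_ge0 //.
exact: pwD.
Qed.

Lemma pointsZ a f : points X f -> points X (a *: f).
Proof.
move=> /pointsP hf; apply/pointsP => e e0.
have c0 : 0 < mpow a + 1 by rewrite ltr_wpDl ?mpow_ge0.
have [K hK] := hf (e / (mpow a + 1)) (divr_gt0 e0 c0); exists K.
have -> : e = (mpow a + 1) * (e / (mpow a + 1)) by rewrite mulrC divfK // gt_eqF.
apply: tle_mono (tleZ (ltW c0) hK) => n; rewrite /tailpart.
case: ifP => _; last by rewrite mulr0.
by rewrite pwZ ler_wpM2r ?pw_ge0 // lerDl.
Qed.

Lemma pointsB f g : points X f -> points X g -> points X (f - g).
Proof. by move=> hf hg; rewrite -scaleN1r; apply: pointsD => //; exact: pointsZ. Qed.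

End Space.

(** * Greedy orderings and greedy sets *)

Lemma perm_image_iota (s : nat -> nat) m : injective s ->
  perm_eq [fset s j | j in iota 0 m]%fset (map s (iota 0 m)).
Proof.
move=> s_inj; apply: uniq_perm; rewrite ?fset_uniq ?map_inj_uniq ?iota_uniq // => n.
by apply/imfsetP/mapP => [[j /= jm ->]|[j jm ->]]; exists j.
Qed.

Section GreedyOrdering.
Variables (R : realType) (F : scalar_field R) (c : nat -> F).
Hypothesis hF : good_scalars F.
Hypothesis c_cvg0 : forall e : R, 0 < e -> exists K, forall n, (K <= n)%N -> modulus (c n) < e.

Let u n := modulus (c n).
Let u_ge0 n : 0 <= u n. Proof. exact: modulus_ge0. Qed.

Lemma exists_best (L : seq nat) : exists2 n, n \notin L &
  forall m, m \notin L -> u m < u n \/ u n = u m /\ (n <= m)%N.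
Proof.
have [n1 n1L max1] : exists2 n1, n1 \notin L & forall m, m \notin L -> u m <= u n1.
  have [[n0 [n0L n0pos]]|none] := pselect (exists n0, n0 \notin L /\ 0 < u n0).
    have [K hK] := c_cvg0 n0pos.
    have n0K : (n0 < K)%N by rewrite ltnNge; apply/negP => /hK; rewrite ltxx.
    have [i iK imax] := @arg_max_nat _ (fun m => if m \in L then 0 else u m) K
      (leq_ltn_trans (leq0n _) n0K).
    have := imax _ n0K; rewrite (negbTE n0L); case: ifPn => iL le0.
      by rewrite leNgt n0pos in le0.
    exists i => // m mL; have [mK|Km] := ltnP m K.
      by have := imax _ mK; rewrite (negbTE mL) (negbTE iL).
    exact: ltW (lt_le_trans (hK _ Km) le0).
  have inL : (\max_(x <- L) x).+1 \notin L.
    by apply/negP => /(@leq_bigmax_seq _ L predT id) /(_ isT); rewrite ltnn.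
  exists (\max_(x <- L) x).+1 => // m mL; apply: le_trans (u_ge0 _).
  by rewrite leNgt; apply/negP => pos; apply: none; exists m.
have ex : exists n, (n \notin L) && (u n == u n1) by exists n1; rewrite n1L eqxx.
have [n /andP[nL /eqP un] minn] := ex_minnP ex.
exists n => // m mL; rewrite un; have := max1 m mL.
rewrite le_eqVlt => /orP[/eqP um|]; last by left.
by right; split => //; apply: minn; rewrite mL um eqxx.
Qed.

(** The best index not yet used is chosen again and again. If a nonzero coefficient were never
    chosen, the infinitely many chosen ones would be at least as large, against convergence to 0. *)
Lemma exists_greedy_ordering : exists rho, is_greedy_ordering c rho.
Proof.
have /choice[best bestP] (L : seq nat) : exists n, n \notin L /\
    forall m, m \notin L -> u m < u n \/ u n = u m /\ (n <= m)%N.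
  by have [n nL P] := exists_best L; exists n.
pose hist k := iter k (fun L => best L :: L) [::].
pose rho k := best (hist k).
have in_hist j k : (j < k)%N -> rho j \in hist k.
  elim: k => // k IH; rewrite ltnS leq_eqVlt => /predU1P[->|/IH jk].
    by rewrite inE eqxx.
  by rewrite inE jk orbT.
have notin_hist j k : (j <= k)%N -> rho k \notin hist j.
  move=> jk; apply: contra (bestP (hist k)).1 => rj; rewrite -/(rho k).
  have mono l : {subset hist j <= hist (j + l)%N}.
    elim: l => [|l IH] x; first by rewrite addn0.
    by move=> /IH; rewrite addnS inE => ->; rewrite orbT.
  by rewrite -(subnKC jk) in rj *; exact: mono.
have neq j k : (j < k)%N -> rho j != rho k.
  move=> jk; apply/eqP => E; have := notin_hist k k (leqnn k).
  by rewrite -E in_hist.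
have rho_inj : injective rho.
  by move=> j k E; have [/neq|/neq|//] := ltngtP j k; rewrite E eqxx.
exists rho; split; [exact: rho_inj | move=> n /= nz | move=> j k jk].
  apply: contrapT => nrange.
  have n_pos : 0 < u n.
    rewrite lt_def u_ge0 andbT; apply: contra_neq nz; exact: modulus_eq0.
  have nh k : n \notin hist k.
    elim: k => // k IH; rewrite inE negb_or IH andbT; apply/eqP => E.
    by apply: nrange; exists k.
  have [K hK] := c_cvg0 n_pos.
  have rhoK k : (rho k < K)%N.
    rewrite ltnNge; apply/negP => /hK lt.
    have [] := (bestP (hist k)).2 n (nh k); rewrite -/(rho k).
      by move=> /(lt_trans lt); rewrite ltxx.
    by move=> [E _]; move: lt; rewrite -/(u _) E ltxx.
  have := @uniq_leq_size _ (map rho (iota 0 K.+1)) (iota 0 K).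
  rewrite map_inj_uniq // iota_uniq size_map !size_iota ltnn => /(_ isT) H.
  suff : false by []. apply: H => _ /mapP[k _ ->]; by rewrite mem_iota rhoK.
have [lt|[E le]] := (bestP (hist j)).2 (rho k) (notin_hist j k (ltnW jk)).
  by left.
by right; split => //; rewrite ltn_neqAle neq.
Qed.

(** This frees the later estimates from the ordering: they need only a set whose coefficients
    dominate all others, whatever the tie-breaking. *)
Lemma greedy_set m : exists G : {fset nat}, [/\ #|` G| = m,
  forall (V : zmodType) (h : nat -> V),
    \sum_(j < m) h (greedy_ordering c j) = \sum_(n <- G) h n &
  forall n q, n \notin G -> q \in G -> modulus (c n) <= modulus (c q)].
Proof.
have [] : is_greedy_ordering c (greedy_ordering c).
  pose S := [set rho | is_greedy_ordering c rho].
  suff : S (greedy_ordering c) by [].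
  by apply: xgetPex; exact: exists_greedy_ordering.
set rho := greedy_ordering c => rho_inj cover sorted.
pose G := [fset rho j | j in iota 0 m]%fset.
have permG : perm_eq G (map rho (iota 0 m)) := perm_image_iota m rho_inj.
exists G; split.
- by rewrite (perm_size permG) size_map size_iota.
- move=> V h; rewrite (perm_big _ permG) big_map -(big_mkord xpredT (fun j => h (rho j))).
  by rewrite /index_iota subn0.
- move=> n q nG; rewrite (perm_mem permG) => /mapP[j jm ->].
  have [->|nz] := eqVneq (c n) 0; first by rewrite modulus0 // modulus_ge0.
  have [k _ nk] := cover _ nz; have jk : (j < k)%N.
    rewrite ltnNge; apply: contra nG => kj; rewrite (perm_mem permG) -nk map_f //.
    by rewrite mem_iota (leq_ltn_trans kj) //; move: jm; rewrite mem_iota.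
  by have := sorted j k jk; rewrite nk => -[/ltW|[->]].
Qed.

End GreedyOrdering.

(** * The basis carried by the forest: projections, greediness, democracy *)

Section Forest.
Variables (R : realType) (F : scalar_field R) (p : R).
Hypotheses (hF : good_scalars F) (p_gt0 : 0 < p) (p_le1 : p <= 1).
Variables M b : nat -> nat.
Hypotheses (M_gt0 : forall j, (0 < M j)%N) (M_le : forall j, (M j <= 4 ^ j)%N).
Hypothesis b_gt1 : forall j, (1 < b j)%N.
Implicit Types (f g : sequences F) (C s : R) (P : pred nat).

Let X : qspace F := convexified_tsirelson F p.
Local Notation pw := (pw p).
Local Notation mpow := (mpow p).

(** Coordinates outside the trees count as roots, so that the basis vector there is the unit vector
    and the coefficient is the coordinate. *)
Definition nonroot n := (0 < off n < M (blk n))%N.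
Definition par n := (base (blk n) + (off n).-1 %/ b (blk n))%N.

Lemma par_base_add j i : (i < M j)%N -> par (base j + i) = (base j + i.-1 %/ b j)%N.
Proof.
by move=> lti; have lt := ltn_M_gap M_le lti; rewrite /par off_base_add // blk_base_add.
Qed.

Lemma nonroot_base_add j i : (i < M j)%N -> nonroot (base j + i) = (0 < i)%N.
Proof.
move=> lti; have lt := ltn_M_gap M_le lti.
by rewrite /nonroot off_base_add // blk_base_add // lti andbT.
Qed.

Lemma parent_ltn i j : (0 < i)%N -> (i.-1 %/ b j < i)%N.
Proof. by move=> i0; rewrite (leq_ltn_trans (leq_div _ _)) // prednK. Qed.

Lemma par_ltn n : nonroot n -> (par n < n)%N.
Proof.
by move=> /andP[n0 _]; rewrite -{2}(base_off n) /par ltn_add2l parent_ltn.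
Qed.

Lemma blk_par n : nonroot n -> blk (par n) = blk n.
Proof.
move=> /andP[n0 ltn]; rewrite /par blk_base_add //; apply: (ltn_M_gap M_le).
exact: ltn_trans (parent_ltn _ n0) ltn.
Qed.

Definition edge n : F :=
  if nonroot n then of_real F ((b (blk n))%:R `^ (- p^-1)) else 0.

Lemma mpow_edge n : mpow (edge n) = if nonroot n then (b (blk n))%:R^-1 else 0.
Proof.
rewrite /edge; case: ifP => _; last exact: mpow0.
rewrite /mpow (modulus_real hF) ger0_norm ?powR_ge0 // -powRrM mulNr mulVf ?gt_eqF //.
by rewrite powR_inv1.
Qed.

Lemma edge_root n : ~~ nonroot n -> edge n = 0.
Proof. by rewrite /edge => /negbTE ->. Qed.

Definition tree_vec k : sequences F :=
  fun n => (n == k)%:R - edge n * (par n == k)%:R.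

(** Comparing n-th coordinates in f = sum of c_k x_k gives c_n = f_n + [edge n] * c_(par n). Fuel
    replaces well-founded recursion: parents have smaller indices, so n steps reach a root, where
    [edge] vanishes. *)
Fixpoint coef_rec fuel n f : F :=
  f n + if fuel is k.+1 then edge n * coef_rec k (par n) f else 0.

Definition coef n f : F := coef_rec n n f.

Lemma coef_rec_fuel k n f : (n <= k)%N -> coef_rec k n f = coef n f.
Proof.
have base0 m l : edge m = 0 -> coef_rec l m f = f m.
  by case: l => [|l] e0 /=; rewrite ?e0 ?mul0r addr0.
rewrite /coef; elim: n {-2}n (leqnn n) k => [|N IH] n.
  rewrite leqn0 => /eqP-> k _; have e0 : edge 0 = 0.
    by apply: edge_root; apply/negP => /par_ltn.
  by rewrite !base0.
move=> nN k nk; have [/par_ltn lt|root] := boolP (nonroot n); last first.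
  by rewrite !base0 // /edge ifN.
case: n nN nk lt => // n nN nk lt; case: k nk => // k nk /=.
by rewrite (IH (par n.+1)) ?(IH (par n.+1) _ n) //; lia.
Qed.

Lemma coef_step n f : coef n f = f n + edge n * coef (par n) f.
Proof.
have [/par_ltn lt|root] := boolP (nonroot n); last first.
  by rewrite /edge ifN // mul0r addr0 /coef; case: n root => [|n] root /=;
    rewrite /edge ?ifN // ?mul0r addr0.
case: n lt => // n lt; rewrite {1}/coef /=.
by rewrite coef_rec_fuel.
Qed.

Lemma coef_linear n (a : F) f g : coef n (a *: f + g) = a * coef n f + coef n g.
Proof.
elim: n {-2}n (leqnn n) => [|N IH] n nN; rewrite !(coef_step n);
  have [/par_ltn lt|root] := boolP (nonroot n).
- by move: lt; rewrite ltnNge (leq_trans nN).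
- by rewrite edge_root // !mul0r !addr0.
- rewrite IH; last by lia.
  have -> : (a *: f + g) n = a * f n + g n by [].
  by rewrite !mulrDr !mulrA [edge n * a]mulrC; ring.
- by rewrite edge_root // !mul0r !addr0.
Qed.

Lemma coef_tree_vec n k : coef n (tree_vec k) = (n == k)%:R.
Proof.
elim: n {-2}n (leqnn n) => [|N IH] n nN; rewrite coef_step /tree_vec;
  have [/par_ltn lt|root] := boolP (nonroot n).
- by move: lt; rewrite ltnNge (leq_trans nN).
- by rewrite edge_root // !mul0r subr0 addr0.
- by rewrite IH ?subrK //; lia.
- by rewrite edge_root // !mul0r subr0 addr0.
Qed.

(** The projection in closed form, so that the set of kept coefficients may be infinite, as the
    complement of a finite set is. *)
Definition tree_proj P f : sequences F :=
  fun n => (if P n then coef n f else 0) -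
           edge n * (if P (par n) then coef (par n) f else 0).

Lemma sum_delta (A : {fset nat}) (c : nat -> F) m :
  \sum_(n <- A) c n * (m == n)%:R = if m \in A then c m else 0.
Proof.
case: ifP => [mA|/negP mA].
  rewrite (bigD1_seq m) ?fset_uniq //= eqxx mulr1 big1 ?addr0 // => n /negbTE ne.
  by rewrite eq_sym ne mulr0.
rewrite big1_seq // => n /= nA; rewrite (_ : m == n = false) ?mulr0 //.
by apply/eqP => mn; apply: mA; rewrite mn.
Qed.

Lemma sum_tree_vecE (A : {fset nat}) (c : nat -> F) m :
  (\sum_(n <- A) c n *: tree_vec n : sequences F) m =
  (if m \in A then c m else 0) - edge m * (if par m \in A then c (par m) else 0).
Proof.
rewrite fct_sumE; rewrite (eq_bigr (fun n =>
    c n * (m == n)%:R - edge m * (c n * (par m == n)%:R))); last first.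
  move=> n _; rewrite /tree_vec -[LHS]/(c n * _) mulrBr; congr (_ - _).
  by rewrite mulrCA.
by rewrite sumrB -mulr_sumr !sum_delta.
Qed.

Lemma coord_projectionE (A : {fset nat}) f :
  coord_projection (X := X) tree_vec coef A f = tree_proj (fun n => n \in A) f.
Proof. by apply: funext => m; rewrite /coord_projection sum_tree_vecE. Qed.

Lemma proj_setT f : tree_proj xpredT f = f.
Proof. by apply: funext => n; rewrite /tree_proj (coef_step n) addrK. Qed.

(** No edge leaves a block, so at a block boundary cutting coefficients and cutting coordinates are
    the same. *)
Lemma proj_headpart j f n :
  tree_proj (fun n => (n < base j)%N) f n = if (n < base j)%N then f n else 0.
Proof.
rewrite /tree_proj; have [nr|root] := boolP (nonroot n); last first.
  by rewrite edge_root // mul0r subr0 coef_step edge_root // mul0r addr0.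
rewrite !ltn_blk_base blk_par //; case: ifP => _.
  by rewrite (coef_step n) addrK.
by rewrite mulr0 subr0.
Qed.

Definition wcoef f n : R := mpow (coef n f).

Lemma wcoef_ge0 f n : 0 <= wcoef f n. Proof. exact: mpow_ge0. Qed.
#[local] Hint Resolve wcoef_ge0 : core.

Lemma wcoef_root f n : ~~ nonroot n -> wcoef f n = pw f n.
Proof. by move=> root; rewrite /wcoef coef_step /edge ifN // mul0r addr0. Qed.

Lemma wcoef_par f n : nonroot n -> mpow (edge n * coef (par n) f) =
  wcoef f (par n) / (b (blk n))%:R.
Proof. by move=> nr; rewrite mpowM // mpow_edge nr mulrC. Qed.

Lemma wcoef_child f n : nonroot n ->
  wcoef f n <= wcoef f (par n) / (b (blk n))%:R + pw f n.
Proof.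
by move=> nr; rewrite -wcoef_par // addrC /wcoef {1}coef_step; exact: mpowD.
Qed.

Lemma wcoef_parent f n : nonroot n ->
  wcoef f (par n) / (b (blk n))%:R <= wcoef f n + pw f n.
Proof.
move=> nr; rewrite -wcoef_par // (_ : edge n * _ = coef n f - f n).
  exact: mpowB.
by rewrite [in RHS]coef_step addrC addKr.
Qed.

Lemma off_tree_root n : (M (blk n) <= off n)%N -> ~~ nonroot n.
Proof. by move=> le; rewrite /nonroot [(_ < M _)%N]ltnNge le andbF. Qed.

Section Block.
Variables (f : sequences F) (j : nat).
Let v i := wcoef f (base j + i)%N.
Let D i := pw f (base j + i)%N.

Let v_ge0 i : 0 <= v i. Proof. exact: wcoef_ge0. Qed.
Let D_ge0 i : 0 <= D i. Proof. exact: pw_ge0. Qed.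

Let v_root : v 0%N <= D 0%N.
Proof. by rewrite /v wcoef_root // nonroot_base_add. Qed.

Let v_child i : (0 < i < M j)%N -> v i <= v (i.-1 %/ b j)%N / (b j)%:R + D i.
Proof.
move=> /andP[i0 iM]; have nr : nonroot (base j + i) by rewrite nonroot_base_add.
have := wcoef_child f nr; rewrite par_base_add // blk_base_add //.
exact: (ltn_M_gap M_le).
Qed.

Let v_parent i : (0 < i < M j)%N -> v (i.-1 %/ b j)%N / (b j)%:R <= v i + D i.
Proof.
move=> /andP[i0 iM]; have nr : nonroot (base j + i) by rewrite nonroot_base_add.
have := wcoef_parent f nr; rewrite par_base_add // blk_base_add //.
exact: (ltn_M_gap M_le).
Qed.

Lemma wcoef_block_le i : (i < M j)%N -> wcoef f (base j + i) <= 2 * bsum M (pw f) j.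
Proof. exact: (heap_sup (b_gt1 j) v_ge0 D_ge0 v_root v_child). Qed.

Lemma card_block_le s P : 0 <= s -> (forall n, P n -> s <= wcoef f n) ->
  bsum M (fun n => if P n then s else 0) j <= 2 * bsum M (pw f) j.
Proof.
move=> s0 hP; rewrite /bsum -big_mkcond /=.
apply: (heap_card (b_gt1 j) D_ge0 v_root v_child (P := fun i => P (base j + i)%N)) => //.
by move=> i _; exact: hP.
Qed.

Lemma proj_greedy_block s P : 0 <= s ->
  (forall n, P n -> s <= wcoef f n) -> (forall n, ~~ P n -> wcoef f n <= s) ->
  bsum M (pw (tree_proj P f)) j <= 8 * bsum M (pw f) j.
Proof.
move=> s0 hP hN.
apply: (heap_greedy (b_gt1 j) D_ge0 v_root v_child (P := fun i => P (base j + i)%N)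
         (s := s)) => //.
- by move=> i _; exact: hP.
- by move=> i _; exact: hN.
- rewrite /pw /tree_proj edge_root ?nonroot_base_add // mul0r subr0 /v /wcoef.
  by case: ifP => // _; rewrite mpow0 ?mpow_ge0.
move=> i /andP[i0 iM] /=; have nr : nonroot (base j + i) by rewrite nonroot_base_add.
have wp := wcoef_par f nr; rewrite par_base_add // blk_base_add in wp; last first.
  exact: (ltn_M_gap M_le).
rewrite /pw /tree_proj par_base_add //; case: (P _); case: (P _).
- rewrite /D /pw (_ : _ - _ = f (base j + i)%N) //.
  by rewrite [in LHS]coef_step par_base_add // addrK.
- by rewrite mulr0 subr0.
- by rewrite sub0r mpowN // wp.
- by rewrite mulr0 subr0 mpow0.
Qed.

(** A coordinate of the projection is at most the kept weight of its node plus a 1/b share of that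
    of the parent. Summed over the tree the shares give the kept weights at most once more, which
    doubles the bound of [heap_top]. *)
Lemma proj_top_block r P :
  (count (fun i => P (base j + i)%N) (iota 0 (M j)) <= b j ^ r)%N ->
  bsum M (pw (tree_proj P f)) j <= 2 * (2 + r%:R) * bsum M (pw f) j.
Proof.
move=> hP; have := heap_top (b_gt1 j) v_ge0 D_ge0 v_root v_child hP.
rewrite -mulrA -/(bsum M (pw f) j) => le.
have b0 : 0 < (b j)%:R :> R by rewrite ltr0n ltnW.
pose h q := if P (base j + q)%N then v q else 0.
have h0 q : 0 <= h q by rewrite /h; case: ifP.
move: le; rewrite big_mkcond -/h => le.
apply: (@le_trans _ _ (2 * \sum_(0 <= i < M j) h i)); last by rewrite ler_pM2l.
rewrite mulr_natl mulr2n; rewrite /bsum big_ltn // [X in _ <= X + _]big_ltn // -addrA.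
rewrite lerD //.
  rewrite /pw /tree_proj edge_root ?nonroot_base_add // mul0r subr0 /h /v /wcoef.
  by case: ifP => // _; rewrite mpow0.
apply: (@le_trans _ _ (\sum_(1 <= i < M j) (h i + h (i.-1 %/ b j)%N / (b j)%:R))).
  rewrite big_nat [leRHS]big_nat; apply: ler_sum => i /andP[i0 iM].
  have nr : nonroot (base j + i) by rewrite nonroot_base_add.
  have wp := wcoef_par f nr; rewrite par_base_add // blk_base_add in wp; last first.
    exact: (ltn_M_gap M_le).
  apply: le_trans (mpowB hF p_gt0 p_le1 _ _) _; apply: lerD.
    by rewrite /h /v /wcoef; case: ifP => // _; rewrite mpow0.
  rewrite par_base_add // /h /v; case: ifP => _; first by rewrite wp.
  by rewrite mulr0 mpow0 // mul0r.
rewrite big_split /= lerD2l -mulr_suml ler_pdivrMr // mulrC.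
by apply: sum_parents_le => //; exact: ltnW.
Qed.

End Block.

Lemma pw_proj_off_tree P f n : (M (blk n) <= off n)%N -> pw (tree_proj P f) n <= pw f n.
Proof.
move=> /off_tree_root root; rewrite /pw /tree_proj edge_root // mul0r subr0.
case: ifP => _; last by rewrite mpow0 ?mpow_ge0.
by rewrite -/(wcoef f n) wcoef_root.
Qed.

Lemma wcoef_le f C n : tle (pw f) C -> wcoef f n <= 4 * C.
Proof.
move=> hf; have C0 := tle_ge0 hf; have [lt|ge] := ltnP (off n) (M (blk n)).
  rewrite -(base_off n); apply: le_trans (wcoef_block_le f lt) _.
  by have := bsum_le M_le (blk n) (pw_ge0 p f) hf; lra.
rewrite wcoef_root ?off_tree_root //; apply: le_trans (tle_coord n hf) _; lra.
Qed.

(** Quasi-greediness. The constant is 5, from the transfer between blocks, times 8, from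
    [heap_greedy]. *)
Lemma tle_proj_greedy f C s P : 0 <= s ->
  (forall n, P n -> s <= wcoef f n) -> (forall n, ~~ P n -> wcoef f n <= s) ->
  tle (pw f) C -> tle (pw (tree_proj P f)) (40 * C).
Proof.
move=> s0 hP hN hf; have -> : 40 * C = 5 * 8 * C by ring.
apply: (tle_block_dominated M_gt0 M_le) hf => //.
- exact: pw_ge0.
- exact: pw_ge0.
- by move=> j; apply: proj_greedy_block s0 hP hN.
- move=> n /pw_proj_off_tree le; apply: le_trans (le _ _) _.
  by have := pw_ge0 p f n; lra.
Qed.

Lemma tle_proj_top f C (rho : R) P : 1 <= rho ->
  (forall j, exists2 r, (count (fun i => P (base j + i)%N) (iota 0 (M j)) <= b j ^ r)%N &
                        r%:R <= rho) ->
  tle (pw f) C -> tle (pw (tree_proj P f)) (30 * rho * C).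
Proof.
(* The 6 works because r <= rho and rho >= 1 give 2 * (2 + r) <= 6 rho. *)
move=> rho1 hP hf; have -> : 30 * rho * C = 5 * (6 * rho) * C by ring.
apply: (tle_block_dominated M_gt0 M_le) hf.
- lra.
- exact: pw_ge0.
- exact: pw_ge0.
- move=> j; have [r cr rle] := hP j; apply: le_trans (proj_top_block f cr) _.
  apply: ler_wpM2r; first by apply: bsum_ge0; exact: pw_ge0.
  by lra.
- move=> n /pw_proj_off_tree le; apply: le_trans (le _ _) _.
  rewrite ler_peMl ?pw_ge0 //; lra.
Qed.

(** The lower half of democracy. By [heap_card] the sequence equal to s on B is dominated by f tree
    by tree, so its norm is at most 10 C; [tle_card] then counts B across the blocks for another
    factor 4. *)
Lemma card_wcoef_le f C s (B : {fset nat}) : 0 < s ->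
  (forall n, n \in B -> s <= wcoef f n) -> tle (pw f) C ->
  s * #|` B|%:R <= 40 * C.
Proof.
move=> s0 hB hf; have hs : tle (fun n => if n \in B then s else 0) (5 * 2 * C).
  apply: (tle_block_dominated M_gt0 M_le) hf => //.
  - by move=> n; case: ifP => // _; exact: ltW.
  - exact: pw_ge0.
  - by move=> j; apply: card_block_le => //; exact: ltW.
  - move=> n off; case: ifP => [/hB|_]; last by rewrite mulr_ge0 ?pw_ge0.
    rewrite wcoef_root ?off_tree_root // => le; apply: le_trans le _.
    by have := pw_ge0 p f n; lra.
have si : 0 <= s^-1 by rewrite invr_ge0 ltW.
have /tle_card : tle (fun n => (n \in B)%:R) (s^-1 * (5 * 2 * C)).
  apply: tle_mono (tleZ si hs) => n; case: ifP => _; last by rewrite mulr0.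
  by rewrite mulVf // gt_eqF.
by move=> le; rewrite mulrC -ler_pdivlMr //; apply: le_trans le _; rewrite mulrC;
  lra.
Qed.

Lemma coef_proj P f n : coef n (tree_proj P f) = if P n then coef n f else 0.
Proof.
elim: n {-2}n (leqnn n) => [|N IH] n nN; rewrite (coef_step n (tree_proj P f));
  have [nr|root] := boolP (nonroot n).
- by have := par_ltn nr; rewrite ltnNge (leq_trans nN).
- by rewrite /tree_proj edge_root // !mul0r subr0 addr0.
- by rewrite IH ?subrK //; have := par_ltn nr; lia.
- by rewrite /tree_proj edge_root // !mul0r subr0 addr0.
Qed.

Lemma proj_comp P (Q : pred nat) f : tree_proj Q (tree_proj P f) = tree_proj (fun n => P n && Q n) f.
Proof.
apply: funext => n; rewrite /tree_proj !coef_proj -!/(tree_proj _ _).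
by case: (P n); case: (Q n); case: (P (par n)); case: (Q (par n)).
Qed.

Lemma proj_split P f : tree_proj P f + tree_proj (fun n => ~~ P n) f = f.
Proof.
apply: funext => n; have -> : (tree_proj P f + tree_proj (fun n => ~~ P n) f) n =
  tree_proj P f n + tree_proj (fun n => ~~ P n) f n by [].
rewrite /tree_proj -{5}(proj_setT f) /tree_proj.
by case: (P n); case: (P (par n)) => /=; ring.
Qed.

Definition unit_vec k : sequences F := fun n => (n == k)%:R.

Lemma coef_unit_vec n k : (n <= k)%N -> coef n (unit_vec k) = (n == k)%:R.
Proof.
elim: n {-2}n (leqnn n) => [|N IH] n nN nk; rewrite coef_step;
  have [nr|root] := boolP (nonroot n).
- by have := par_ltn nr; rewrite ltnNge (leq_trans nN).
- by rewrite edge_root // mul0r addr0.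
- have lt := par_ltn nr; rewrite IH; [|lia|lia].
  by rewrite (_ : par n == k = false) ?mulr0 ?addr0 //; lia.
- by rewrite edge_root // mul0r addr0.
Qed.

Lemma proj_unit_vec k : tree_proj (pred1 k) (unit_vec k) = tree_vec k.
Proof.
apply: funext => n; rewrite /tree_proj /tree_vec /=.
have E m : (if m == k then coef m (unit_vec k) else 0) = (m == k)%:R.
  by case: eqP => // ->; rewrite coef_unit_vec // eqxx.
by rewrite !E.
Qed.

Lemma pw_unit_vec k n : pw (unit_vec k) n = (n == k)%:R.
Proof. by rewrite /pw /unit_vec; case: eqP => _; rewrite ?mpow1 ?mpow0. Qed.

Lemma tle_unit_vec k : tle (pw (unit_vec k)) 1.
Proof.
move=> phi hphi N; apply: le_trans (_ : \sum_(0 <= n < N) (if n == k then phi n else 0) <= _).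
  apply: ler_sum => n _; rewrite pw_unit_vec; case: eqP => _; rewrite ?mulr1 ?mulr0 //.
rewrite -big_mkcond -big_filter /=; case: (boolP (k \in index_iota 0 N)) => kN.
  by rewrite filter_pred1_uniq ?iota_uniq // big_seq1 norming_le1.
rewrite big1_seq // => n /andP[_]; rewrite mem_filter => /andP[/eqP ->].
by rewrite (negbTE kN).
Qed.

(** x_k is the projection of the unit vector e_k on the single coefficient k, so r = 0 and rho = 1
    are allowed. *)
Lemma tle_tree_vec k : tle (pw (tree_vec k)) 30.
Proof.
rewrite -proj_unit_vec -[30]mulr1 -[30]mulr1.
apply: (tle_proj_top) (tle_unit_vec k) => // j.
exists 0%N; rewrite ?ler01 // expn0.
have inj : injective (fun i => (base j + i)%N) by move=> i i' /addnI.
rewrite -(count_map (fun i => (base j + i)%N) (pred1 k)) count_uniq_mem ?leq_b1 //.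
by rewrite map_inj_uniq // iota_uniq.
Qed.

Lemma points_tree_vec k : points X (tree_vec k).
Proof.
apply: (points_finite hF p_gt0 (K := base (blk k).+1)) => n le.
rewrite /tree_vec (_ : n == k = false) ?sub0r; last first.
  by apply/eqP => nk; move: le; rewrite nk leqNgt ltn_base_blk.
have [nr|root] := boolP (nonroot n); last by rewrite edge_root // mul0r oppr0.
rewrite (_ : par n == k = false) ?mulr0 ?oppr0 //; apply/eqP => pk.
by move: le; rewrite -pk blk_par // leqNgt ltn_base_blk.
Qed.

Lemma points_sum (A : seq nat) (c : nat -> F) :
  points X (\sum_(n <- A) c n *: tree_vec n : sequences F).
Proof.
elim: A => [|n A IH]; first by rewrite big_nil; exact: (points_finite hF p_gt0 (K := 0%N)).
rewrite big_cons; apply: (pointsD hF p_gt0 p_le1) IH.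
apply: (pointsZ hF); exact: points_tree_vec.
Qed.

(** The upper half of democracy is mere subadditivity of p-th powers. *)
Lemma tle_sum (A : seq nat) (c : nat -> F) s : (forall n, n \in A -> mpow (c n) <= s) ->
  tle (pw (\sum_(n <- A) c n *: tree_vec n : sequences F)) (30 * s * (size A)%:R).
Proof.
elim: A => [|n A IH] hs.
  rewrite big_nil mulr0; apply: tle_l1 => [n|N]; first exact: pw_ge0.
  by rewrite big1 // => n _; rewrite /pw mpow0.
rewrite big_cons (_ : 30 * s * _ = 30 * s + 30 * s * (size A)%:R); last first.
  by rewrite /= -[(size A).+1%:R]natr1; ring.
apply: tle_mono (tleD (C := 30 * s) _ (IH _)) => [m||m mA]; first exact: pwD.
  apply: tle_weaken (_ : mpow (c n) * 30 <= _) _.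
    by rewrite mulrC ler_pM2l // hs ?mem_head.
  apply: tle_mono (tleZ (mpow_ge0 p (c n)) (tle_tree_vec n)) => m.
  by rewrite pwZ.
by apply: hs; rewrite inE mA orbT.
Qed.

Lemma points_proj (A : {fset nat}) f : points X (tree_proj (fun n => n \in A) f).
Proof. by rewrite -coord_projectionE //; exact: points_sum. Qed.

Lemma coef_sum (A : seq nat) (c : nat -> F) l :
  coef l (\sum_(n <- A) c n *: tree_vec n) = \sum_(n <- A) c n * (l == n)%:R.
Proof.
elim: A => [|n A IH]; last by rewrite !big_cons coef_linear IH coef_tree_vec.
rewrite !big_nil; have := coef_linear l (-1) 0 0.
by rewrite scaler0 addr0 mulN1r addNr.
Qed.

Lemma modulus_mpow (a : F) : modulus a = mpow a `^ p^-1.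
Proof. by rewrite /mpow powRKV // modulus_ge0. Qed.

Lemma modulus_coef_le f n : points X f ->
  modulus (coef n f) <= 4 `^ p^-1 * qnorm (f : ambient X).
Proof.
move=> hf; have le := wcoef_le n (tle_qnorm hF p_gt0 hf).
rewrite modulus_mpow; apply: le_trans (ler_powRV p_gt0 (mpow_ge0 p _) le) _.
by rewrite powRM ?powR_ge0 // powRKV // qnorm_ge0.
Qed.

Lemma tree_basis : is_basis (X := X) tree_vec coef.
Proof.
split.
- split; first exact: points_tree_vec.
  exists (30 `^ p^-1) => n; apply: (qnorm_le hF p_gt0); first exact: points_tree_vec.
  exact: tle_tree_vec.
- move=> f hf e e0.
  have d0 : 0 < (e / 2) `^ p by rewrite powR_gt0 // divr_gt0.
  have /(pointsP p hF) /(_ _ d0)[K hK] := hf.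
  (* At a block boundary the projection is a truncation, so what remains is a tail of f. *)
  pose A := [fset n in iota 0 (base K)]%fset.
  have inA n : (n \in A) = (n < base K)%N by rewrite !inE mem_iota.
  exists A, (fun n => coef n f).
  rewrite -/(coord_projection (X := X) tree_vec coef A f).
  have subE n : (f - coord_projection (X := X) tree_vec coef A f) n =
      if (n < base K)%N then 0 else f n.
    rewrite coord_projectionE (_ : (fun n => n \in A) = (fun n => (n < base K)%N)).
      rewrite -[LHS]/(f n - _) proj_headpart //.
      by case: ifP => _; rewrite ?subrr ?subr0.
    by apply: funext.
  have hA : points X (f - coord_projection (X := X) tree_vec coef A f).
    by apply: (pointsB hF p_gt0 p_le1) => //; exact: points_sum.
  apply: le_lt_trans (_ : e / 2 < e); last by rewrite ltr_pdivrMr // ltr_pMr // ltr1n.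
  have e20 : 0 <= e / 2 by rewrite divr_ge0 // ltW.
  rewrite -(powRKV p_gt0 e20); apply: (qnorm_le hF p_gt0) => //.
  apply: tle_mono hK => n; rewrite /pw subE /tailpart.
  have [lt|ge] := ltnP n (base K).
    by rewrite mpow0 //; case: ifP => // _; exact: mpow_ge0.
  by rewrite (leq_trans (leq_base_id K) ge).
- split; first by move=> n a f g _ _; exact: coef_linear.
  by exists (4 `^ p^-1) => n f; exact: modulus_coef_le.
- by move=> n k; exact: coef_tree_vec.
Qed.

(** From a block boundary on, the coefficients are those of a tail of f, whose norm is small. This
    makes greedy orderings exist. *)
Lemma coef_cvg0 f : points X f -> forall e : R, 0 < e ->
  exists K, forall n, (K <= n)%N -> modulus (coef n f) < e.
Proof.
move=> hf e e0; have d0 : 0 < (e / 2) `^ p / 4 by rewrite divr_gt0 // powR_gt0 // divr_gt0.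
have /(pointsP p hF) /(_ _ d0)[K hK] := hf.
exists (base K) => n len.
pose P := (fun n => (n < base K)%N).
pose g : sequences F := tree_proj (fun n => ~~ P n) f.
have gE m : g m = if (m < base K)%N then 0 else f m.
  have : tree_proj P f m + g m = f m by rewrite -{2}(proj_split P f).
  rewrite proj_headpart // => /(canRL (addKr _)) ->.
  by case: ifP => _; rewrite ?addNr ?oppr0 ?add0r.
have hg : tle (pw g) ((e / 2) `^ p / 4).
  apply: tle_mono hK => m; rewrite /pw gE /tailpart.
  have [lt|ge] := ltnP m (base K).
    by rewrite mpow0 //; case: ifP => // _; exact: mpow_ge0.
  by rewrite (leq_trans (leq_base_id K) ge).
have := wcoef_le n hg; rewrite /wcoef coef_proj /P -leqNgt len [leRHS]mulrC divfK //.
move=> /(ler_powRV p_gt0 (mpow_ge0 p _)) le.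
apply: (@le_lt_trans _ _ (e / 2)); last by rewrite ltr_pdivrMr // ltr_pMr // ltr1n.
by rewrite modulus_mpow (le_trans le) // powRKV // divr_ge0 // ltW.
Qed.

(** With g = f - P_A f one has f - P_G f = (g - P_(G\A) g) + P_(A\G) f. The set G\A is greedy for g,
    which costs 40. The sets A\G and G\A have equal size, and s, the least weight on G\A, is at
    least every weight on A\G, so democracy bounds the last term with 30 * 40. In all 1 + 40 + 1200
    = 1241. *)
Lemma greedy_remainder f (A G : {fset nat}) : points X f -> #|` A| = #|` G| ->
  (forall n q, n \notin G -> q \in G -> wcoef f n <= wcoef f q) ->
  qnorm (f - tree_proj (fun n => n \in G) f : ambient X) <=
    1241 `^ p^-1 * qnorm (f - tree_proj (fun n => n \in A) f : ambient X).
Proof.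
move=> hf cAG greedy.
pose g := f - tree_proj (fun n => n \in A) f.
have gE : g = tree_proj (fun n => n \notin A) f.
  by rewrite /g -{1}(proj_split (fun n => n \in A) f) addrC addKr.
have pg : points X g by apply: (pointsB hF p_gt0 p_le1) => //; exact: points_proj.
have hg := tle_qnorm hF p_gt0 pg.
set Q := _ `^ p in hg; have Q0 := tle_ge0 hg.
have pG : points X (f - tree_proj (fun n => n \in G) f).
  by apply: (pointsB hF p_gt0 p_le1) => //; exact: points_proj.
suff : tle (pw (f - tree_proj (fun n => n \in G) f)) (1241 * Q).
  have Qroot : Q `^ p^-1 = qnorm (g : ambient X).
    exact: (powRKV p_gt0 (qnorm_ge0 hF pg)).
  move=> H; apply: le_trans (qnorm_le hF p_gt0 pG H) _.
  rewrite (powRM _ (ler0n R 1241) Q0) Qroot; exact: lexx.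
have wg n : wcoef g n = if n \in A then 0 else wcoef f n.
  by rewrite gE /wcoef coef_proj; case: (n \in A); rewrite //= mpow0.
have [GA0|/fset0Pn[q0 q0GA]] := eqVneq (G `\` A)%fset fset0.
  have GA : G = A.
    by apply/eqP; rewrite eqEfcard cAG leqnn andbT -fsetD_eq0 GA0.
  by subst G; apply: tle_weaken hg; lra.
have [q qGA qmin] : exists2 q, q \in (G `\` A)%fset &
    forall n, n \in (G `\` A)%fset -> wcoef f q <= wcoef f n.
  have [i _ imin] := @arg_minP _ _ _ [` q0GA]%fset xpredT (fun q => wcoef f (val q)) isT.
  exists (val i); first exact: valP.
  by move=> n nGA; have := imin [` nGA]%fset isT.
have [qG qA] : q \in G /\ q \notin A by move: qGA; rewrite in_fsetD => /andP[].
pose s := wcoef f q; have s0 : 0 <= s by exact: wcoef_ge0.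
have h1 : tle (pw (tree_proj (fun n => n \in (G `\` A)%fset) g)) (40 * Q).
  apply: (tle_proj_greedy (s := s)) hg => // n.
    move=> nGA; rewrite wg; have := qmin n nGA.
    by move: nGA; rewrite in_fsetD => /andP[/negbTE -> _].
  rewrite in_fsetD negb_and negbK wg; case: (boolP (n \in A)) => //= nA nG.
  exact: greedy.
have h2 : s * #|` (G `\` A)%fset|%:R <= 40 * Q.
  have [->|snz] := eqVneq s 0; first by rewrite mul0r; lra.
  apply: (card_wcoef_le) hg; first by rewrite lt_def snz.
  move=> n nGA; rewrite wg; have := qmin n nGA.
  by move: nGA; rewrite in_fsetD => /andP[/negbTE -> _].
have cD : #|` (A `\` G)%fset| = #|` (G `\` A)%fset|.
  by rewrite !cardfsD cAG fsetIC.
have h3 : tle (pw (tree_proj (fun n => n \in (A `\` G)%fset) f)) (1200 * Q).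
  rewrite -coord_projectionE //; apply: (tle_weaken _ (tle_sum (s := s) _)); last first.
    move=> n; rewrite in_fsetD => /andP[nG _]; exact: greedy.
  rewrite cD; lra.
have -> : f - tree_proj (fun n => n \in G) f =
    (g - tree_proj (fun n => n \in (G `\` A)%fset) g) + tree_proj (fun n => n \in (A `\` G)%fset) f.
  have -> : f - tree_proj (fun n => n \in G) f = tree_proj (fun n => n \notin G) f.
    by rewrite -{1}(proj_split (fun n => n \in G) f) addrC addKr.
  have -> : g - tree_proj (fun n => n \in (G `\` A)%fset) g =
      tree_proj (fun n => n \notin (G `\` A)%fset) g.
    by rewrite -{1}(proj_split (fun n => n \in (G `\` A)%fset) g) addrC addKr.
  rewrite gE proj_comp -{1}(proj_split (fun n => n \in A) (tree_proj (fun n => n \notin G) f)).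
  rewrite !proj_comp addrC; congr (tree_proj _ f + tree_proj _ f); apply: funext => n;
    by rewrite !in_fsetD; case: (n \in A); case: (n \in G).
have -> : 1241 * Q = (Q + 40 * Q) + 1200 * Q by ring.
apply: tle_mono (tleD (tleD hg h1) h3) => n.
apply: le_trans (pwD hF p_gt0 p_le1 _ _ _) _; rewrite lerD2r.
apply: le_trans (pwD hF p_gt0 p_le1 _ _ _) _; rewrite lerD2l.
by rewrite /pw seqNE mpowN.
Qed.

Lemma powRV_ge1 C : 1 <= C -> 1 <= C `^ p^-1.
Proof. by move=> /(ler_powRV p_gt0 ler01); rewrite powR1. Qed.

Lemma tree_almost_greedy : almost_greedy_basis (X := X) tree_vec coef.
Proof.
exists (1241 `^ p^-1); first by apply: powRV_ge1; rewrite ler1n.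
move=> f hf m _; have C0 : 0 < 1241 `^ p^-1 :> R by apply: powR_gt0; rewrite ltr0n.
have [G [cG sumG greedy]] := greedy_set hF (coef_cvg0 hf) m.
have -> : greedy_sum (X := X) tree_vec coef m f = tree_proj (fun n => n \in G) f.
  rewrite -coord_projectionE // /greedy_sum /coord_projection.
  exact: (sumG (sequences F) (fun n => coef n f *: tree_vec n)).
rewrite -ler_pdivrMl //; apply: lb_le_inf.
  by eexists; exists G.
move=> _ [A /= cA <-]; rewrite ler_pdivrMl // coord_projectionE //.
apply: greedy_remainder => //; first by rewrite cA cG.
by move=> n q nG qG; rewrite /wcoef mpow_le //; exact: greedy.
Qed.

Lemma tree_fundamental_function :
  equivalent_from 1 (fundamental_function (X := X) tree_vec) (fun m => m%:R `^ p^-1).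
Proof.
exists (40^-1 `^ p^-1), (30 `^ p^-1); split.
- by rewrite powR_gt0 // invr_gt0.
- by apply: ler_powRV => //; lra.
have sum1 (A : {fset nat}) : \sum_(n <- A) tree_vec n =
    \sum_(n <- A) (fun=> 1 : F) n *: tree_vec n :> sequences F.
  by apply: eq_bigr => n _; rewrite scale1r.
move=> m m1; split.
  pose A := [fset n in iota 0 m]%fset.
  have cA : #|` A| = m.
    have /perm_size : perm_eq A (iota 0 m).
      by apply: uniq_perm; rewrite ?fset_uniq ?iota_uniq // => n; rewrite !inE.
    by rewrite size_iota.
  apply: le_trans (ereal_sup_ubound _); last by exists A; rewrite /= ?cA.
  rewrite lee_fin -powRM ?invr_ge0 // sum1.
  set g := \sum_(n <- A) _; have pg : points X g by exact: points_sum.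
  have wg n : n \in A -> 1 <= wcoef g n.
    by move=> nA; rewrite /wcoef /g coef_sum sum_delta nA mpow1.
  have := card_wcoef_le ltr01 wg (tle_qnorm hF p_gt0 pg).
  rewrite mul1r cA -ler_pdivrMl ?ltr0n // => le.
  by rewrite -[leRHS](powRKV p_gt0 (qnorm_ge0 hF pg)) ler_powRV // mulr_ge0 ?invr_ge0.
apply: ub_ereal_sup => _ [A /= cA <-]; rewrite lee_fin sum1 -powRM //.
apply: (qnorm_le hF p_gt0); first exact: points_sum.
apply: tle_weaken (tle_sum (s := 1) _) => [|n _]; last by rewrite mpow1.
by rewrite mulr1 ler_pM2l // ler_nat.
Qed.

End Forest.

(** * Choice of depths and arities *)

Fixpoint tree_size b d := if d is d'.+1 then (1 + b * tree_size b d')%N else 1%N.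

Lemma tree_size_le b d : (1 < b)%N -> (tree_size b d < 2 * b ^ d)%N.
Proof.
move=> b1; elim: d => //= d IH; rewrite expnS; nia.
Qed.

Lemma tree_size_gt0 b d : (0 < tree_size b d)%N.
Proof. by case: d. Qed.

Lemma tree_sizeS b d : (0 < b)%N -> (tree_size b d <= tree_size b d.+1)%N.
Proof. by move=> b0; rewrite /= leqW // leq_pmull. Qed.

(** All levels carry the same weight: the b children of a node together have its weight, so dropping
    the root leaves the sum for depth d. *)
Lemma sum_tree_size (R : realType) (v : nat -> R) b d : (0 < b)%N ->
  (forall i, (0 < i < tree_size b d)%N -> v i = v (i.-1 %/ b)%N / b%:R) ->
  \sum_(0 <= i < tree_size b d) v i = d.+1%:R * v 0%N.
Proof.
move=> b0; elim: d => [|d IH] hv; first by rewrite big_nat1 mul1r.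
rewrite [tree_size _ _]/= big_ltn // big_add1 /= add0n.
rewrite (eq_big_nat _ _ (F2 := fun i => (fun q => v q / b%:R) (i %/ b)%N)); last first.
  by move=> i /andP[_ lti]; rewrite hv //= add1n ltnS.
have bnz : b%:R != 0 :> R by rewrite pnatr_eq0 -lt0n.
rewrite -mulr_suml sum_divn // [b%:R * _]mulrC mulfK //.
rewrite IH; first by rewrite -[d.+2%:R]natr1; ring.
move=> i /andP[i0 lti]; apply: hv; rewrite i0; exact: leq_trans (tree_sizeS _ b0).
Qed.

Section Log.
Variable R : realType.

Lemma log2_bounds m : (0 < m)%N ->
  (trunc_log 2 m)%:R <= log2 m%:R :> R /\ log2 m%:R <= (trunc_log 2 m).+1%:R :> R.
Proof.
move=> m0; have ln2 : 0 < ln 2 :> R by rewrite ln_gt0 // ltr1n.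
have lnE k : ln ((2 ^ k)%N%:R) = k%:R * ln 2 :> R.
  by rewrite natrX lnXn // mulr_natl.
have /andP[lo hi] := trunc_log_bounds (isT : 1 < 2)%N m0.
by split; rewrite /log2 ?ler_pdivlMr ?ler_pdivrMr // -lnE ler_ln ?posrE ?ltr0n ?expn_gt0
  // ler_nat // ltnW.
Qed.

End Log.

(** * Concavity of eta and the size of the trees *)

Section Eta.
Variables (R : realType) (eta : R -> R).
Hypothesis eta_ge1 : forall t, 1 <= t -> 1 <= eta t.
Hypothesis eta_concave : concave_on_ray eta.
Hypothesis eta_increasing : forall s t, 1 <= s -> s <= t -> eta s <= eta t.

Lemma eta_conv s x y : 0 <= s -> s <= 1 -> 1 <= x -> 1 <= y ->
  s * eta x + (1 - s) * eta y <= eta (s * x + (1 - s) * y).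
Proof.
move=> s0 s1 x1 y1; have inD (z : R) : 1 <= z -> z \in [set` `[1, +oo[%R].
  by move=> z1; rewrite inE /= in_itv /= z1.
have := eta_concave (Itv01 s0 s1) (inD x x1) (inD y y1).
rewrite !convRE /= /unstable.onem !mulrN -opprD lerN2; exact.
Qed.

Let H := eta 2.
Let H_ge1 : 1 <= H. Proof. by apply: eta_ge1; rewrite ler1n. Qed.

Lemma eta_linear t : 1 <= t -> eta t <= H * t.
Proof.
move=> t1; have [t2|/ltW t2] := leP t 2.
  apply: le_trans (eta_increasing t1 t2) _; rewrite ler_peMr //; exact: le_trans H_ge1.
have t10 : 0 < t - 1 by lra.
have := @eta_conv (t - 1)^-1 t 1; rewrite invr_ge0 (ltW t10) invf_le1 // => /(_ isT).
have -> : 1 <= t - 1 by lra.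
move=> /(_ isT t1 (lexx 1)).
have -> : (t - 1)^-1 * t + (1 - (t - 1)^-1) * 1 = 2.
  by field; rewrite gt_eqF.
have e1 := eta_ge1 (lexx 1).
have : 0 <= 1 - (t - 1)^-1 by rewrite subr_ge0 invf_le1 //; lra.
move=> p0 le; have : (t - 1)^-1 * eta t <= H.
  by apply: le_trans le; rewrite lerDl mulr_ge0 // (le_trans _ e1).
rewrite mulrC ler_pdivrMr // => /le_trans; apply; rewrite ler_pM2l; first by lra.
exact: lt_le_trans H_ge1.
Qed.

(** Concavity makes eta(t)/t decreasing up to the factor 2H. Chords start at 1, so t - 1 appears in
    place of t, and t <= 2 (t - 1) requires t >= 2; smaller t are covered by [eta_linear]. *)
Lemma eta_ratio t u : 1 <= t -> t <= u -> t * eta u <= 2 * H * u * eta t.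
Proof.
move=> t1 tu; have u1 : 1 <= u by exact: le_trans tu.
have et := eta_ge1 t1; have eu := eta_ge1 u1.
have [t2|t2] := leP t 2.
  have le := eta_linear u1.
  apply: (@le_trans _ _ (2 * (H * u))); first by apply: ler_pM => //; lra.
  by rewrite mulrA ler_peMr // mulr_ge0 // ?mulr_ge0 //; have := H_ge1; lra.
have u10 : 0 < u - 1 by lra.
have := @eta_conv ((t - 1) / (u - 1)) u 1.
rewrite divr_ge0 ?subr_ge0 // ler_pdivrMr // mul1r lerD2r tu => /(_ isT isT u1 (lexx 1)).
have -> : (t - 1) / (u - 1) * u + (1 - (t - 1) / (u - 1)) * 1 = t.
  by field; rewrite gt_eqF.
have e1 := eta_ge1 (lexx 1).
have p0 : 0 <= 1 - (t - 1) / (u - 1) by rewrite subr_ge0 ler_pdivrMr // mul1r lerD2r.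
move=> le; have {}le : (t - 1) / (u - 1) * eta u <= eta t.
  by apply: le_trans le; rewrite lerDl mulr_ge0 // (le_trans _ e1).
rewrite mulrAC ler_pdivrMr // in le.
apply: (@le_trans _ _ (2 * ((t - 1) * eta u))).
  by rewrite mulrA ler_pM2r; lra.
have : 2 * ((t - 1) * eta u) <= 2 * (eta t * (u - 1)) by rewrite ler_pM2l.
move=> /le_trans; apply; rewrite -!mulrA ler_pM2l // mulrCA mulrC.
have : 0 <= H - 1 by rewrite subr_ge0.
move=> h0; have : 0 <= (H - 1) * (u * eta t) by rewrite mulr_ge0 // mulr_ge0; lra.
lra.
Qed.

(** Division by eta 2 gives depth at most j, by [eta_linear], which leaves room for arities of at
    least 2. At j = 0, outside the range where eta is controlled, the depth is 0. *)
Definition depth j := if j is 0%N then 0%N else Num.truncn (eta j%:R / eta 2).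
(** The maximum with 1 matters for depth 0, where the quotient is 0 by convention. *)
Definition arity_log j := maxn 1 (j %/ depth j).
Definition arity j := (2 ^ arity_log j)%N.
Definition node_count j := tree_size (arity j) (depth j).

Let nat_ge1 j : 1 <= j.+1%:R :> R. Proof. by rewrite ler1n. Qed.
Let H_gt0 : 0 < H. Proof. exact: lt_le_trans H_ge1. Qed.

Lemma depth_itv j : (0 < j)%N -> (depth j)%:R <= eta j%:R / H < (depth j).+1%:R.
Proof.
case: j => // j _; apply: truncn_itv; rewrite divr_ge0 ?(ltW H_gt0) //.
exact: le_trans (eta_ge1 (nat_ge1 j)).
Qed.

Lemma depth_le j : (depth j <= j)%N.
Proof.
case: j => // j; rewrite -(ler_nat R).
have /andP[le _] := depth_itv (ltn0Sn j); apply: le_trans le _.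
by rewrite ler_pdivrMr // mulrC eta_linear.
Qed.

Lemma leq_depth : {homo depth : i j / (i <= j)%N}.
Proof.
case=> [|i] [|j] // ij; apply: le_truncn; rewrite ler_pM2r ?invr_gt0 //.
by apply: eta_increasing; rewrite ?ler_nat.
Qed.

Lemma arity_gt1 j : (1 < arity j)%N.
Proof. by rewrite /arity -{1}(expn0 2) ltn_exp2l // leq_max. Qed.

Lemma arity_logE j : (0 < depth j)%N -> arity_log j = (j %/ depth j)%N.
Proof.
by move=> d0; apply/maxn_idPr; rewrite leq_divRL // mul1n depth_le.
Qed.

Lemma arity_exp_depth j : (arity j ^ depth j <= 2 ^ j)%N.
Proof.
rewrite -expnM leq_exp2l //; case: (posnP (depth j)) => [->|d0]; first by rewrite muln0.
by rewrite arity_logE // leq_trunc_div.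
Qed.

Lemma node_count_lt j : (node_count j < 2 ^ j.+1)%N.
Proof.
apply: leq_trans (tree_size_le (depth j) (arity_gt1 j)) _.
by rewrite expnS leq_pmul2l // arity_exp_depth.
Qed.

Lemma node_count_gt0 j : (0 < node_count j)%N.
Proof. exact: tree_size_gt0. Qed.

Lemma node_count_le j : (node_count j <= 4 ^ j)%N.
Proof.
have := node_count_lt j; rewrite expnS -[4%N]/(2 * 2)%N expnMn.
have : (0 < 2 ^ j)%N by rewrite expn_gt0.
nia.
Qed.

(** For a block index j >= 1, passing from eta(j) to eta(j + 2) costs 6H, since j + 2 <= 3j, and
    passing to the depth costs another H. The 2 in the denominator anticipates the factor of
    [bsum_le]. *)
Lemma eta_log_le_depth m : (1 < m)%N ->
  eta (log2 m%:R) <= 12 * H ^+ 2 * ((depth (trunc_log 2 m).-1).+1%:R / 2).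
Proof.
move=> m1; have m0 : (0 < m)%N by exact: ltnW.
have [lo hi] := log2_bounds R m0.
have t0 : (0 < trunc_log 2 m)%N by rewrite trunc_log_gt0.
case: (trunc_log 2 m) t0 lo hi => // j _ lo hi /=.
have l1 : 1 <= log2 m%:R :> R by apply: le_trans lo; rewrite ler1n.
apply: le_trans (eta_increasing l1 hi) _.
have -> : 12 * H ^+ 2 * ((depth j).+1%:R / 2) = 6 * H ^+ 2 * (depth j).+1%:R by field.
have H2 : H <= H ^+ 2 by rewrite expr2 ler_peMl // ltW.
have HH : 0 < H ^+ 2 by rewrite exprn_gt0.
case: j lo hi => [|j] lo hi.
  by rewrite /= mulr1 -/H; lra.
have := depth_itv (ltn0Sn j); rewrite ltr_pdivrMr // => /andP[_ lt].
have le : j.+1%:R <= j.+3%:R :> R by rewrite ler_nat; lia.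
have := eta_ratio (nat_ge1 j) le.
have le3 : j.+3%:R <= 3 * j.+1%:R :> R by rewrite -natrM ler_nat; lia.
have j0 : 0 < j.+1%:R :> R by rewrite ltr0n.
have ej := eta_ge1 (nat_ge1 j).
move=> le2; have {}le2 : j.+1%:R * eta j.+3%:R <= j.+1%:R * (6 * H * eta j.+1%:R).
  apply: le_trans le2 _.
  have -> : j.+1%:R * (6 * H * eta j.+1%:R) = 2 * H * (3 * j.+1%:R) * eta j.+1%:R by ring.
  rewrite ler_pM2r ?(lt_le_trans _ ej) // ler_pM2l // mulr_gt0 //.
rewrite ler_pM2l // in le2; apply: le_trans le2 _.
have -> : 6 * H ^+ 2 * (depth j.+1).+1%:R = 6 * H * ((depth j.+1).+1%:R * H) by ring.
by rewrite ler_pM2l ?(ltW lt) // mulr_gt0.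
Qed.

(** If j <= log m, the whole tree is allowed, with its d_j + 1 levels. In a later block m nodes need
    about (log m) / (j / d_j) levels, at most twice d_j (log m) / j after rounding, and [eta_ratio]
    compares d_j / j with eta(log m) / log m. This gives 4, and rounding up makes it 5. *)
Lemma levels_needed m j : (1 < m)%N -> exists r,
  (minn m (node_count j) <= arity j ^ r)%N /\ r%:R <= 5 * eta (log2 m%:R).
Proof.
move=> m1; have m0 : (0 < m)%N by exact: ltnW.
have [lo hi] := log2_bounds R m0; set t := log2 _ in lo hi *.
set k := trunc_log 2 m in lo hi.
have k0 : (0 < k)%N by rewrite trunc_log_gt0.
have t1 : 1 <= t by apply: le_trans lo; rewrite ler1n.
have et := eta_ge1 t1.
have [small|] := boolP ((j <= k)%N || (depth j == 0%N)).
  exists (depth j).+1; split.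
    rewrite geq_min; apply/orP; right.
    apply: leq_trans (ltnW (tree_size_le _ (arity_gt1 j))) _.
    by rewrite expnS leq_mul2r arity_gt1 orbT.
  rewrite -natr1; have [->|d0] := eqVneq (depth j) 0%N; first by lra.
  rewrite (negbTE d0) orbF in small.
  case: j small d0 => // j jk d0.
  have /andP[le _] := depth_itv (ltn0Sn j).
  have : eta j.+1%:R / H <= eta t.
    rewrite ler_pdivrMr //; have : eta j.+1%:R <= eta t.
      by apply: eta_increasing => //; apply: le_trans lo; rewrite ler_nat.
    by move=> /le_trans; apply; rewrite ler_peMr // (le_trans _ et).
  by lra.
rewrite negb_or -ltnNge => /andP[kj d0]; rewrite -lt0n in d0.
exists (k %/ arity_log j).+1; split.
  rewrite geq_min; apply/orP; left; rewrite -expnM.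
  apply: leq_trans (_ : 2 ^ k.+1 <= _)%N.
    by have /andP[_ /ltnW] := trunc_log_bounds (isT : 1 < 2)%N m0.
  by rewrite leq_exp2l // mulnC ltn_ceil // leq_max.
case: j kj d0 => // j kj d0.
have /andP[dle _] := depth_itv (ltn0Sn j).
have key : (k %/ arity_log j.+1 * j.+1 <= 2 * depth j.+1 * k)%N.
  rewrite arity_logE //; set d := depth j.+1 in d0 *.
  have q1 : (0 < j.+1 %/ d)%N by rewrite divn_gt0 // depth_le.
  have := leq_trunc_div k (j.+1 %/ d); have := ltn_ceil j.+1 d0; nia.
have tj : t <= j.+1%:R by apply: le_trans hi _; rewrite ler_nat.
have ratio := eta_ratio t1 tj.
have j0 : 0 < j.+1%:R :> R by rewrite ltr0n.
rewrite ler_pdivlMr // in dle.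
rewrite -natr1; suff : (k %/ arity_log j.+1)%:R <= 4 * eta t by lra.
rewrite -(ler_pM2r (mulr_gt0 j0 H_gt0)).
apply: (@le_trans _ _ (2 * t * eta j.+1%:R)).
  rewrite mulrA -natrM; apply: (@le_trans _ _ ((2 * depth j.+1 * k)%:R * H)).
    by rewrite ler_pM2r // ler_nat.
  rewrite !natrM; have le : (depth j.+1)%:R * H * k%:R <= eta j.+1%:R * t.
    by apply: ler_pM => //; rewrite mulr_ge0 // ltW.
  have -> : 2 * (depth j.+1)%:R * k%:R * H = 2 * ((depth j.+1)%:R * H * k%:R) by ring.
  have -> : 2 * t * eta j.+1%:R = 2 * (eta j.+1%:R * t) by ring.
  by rewrite ler_pM2l.
rewrite -mulrA; have : 2 * (t * eta j.+1%:R) <= 2 * (2 * H * j.+1%:R * eta t).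
  by rewrite ler_pM2l.
by move=> /le_trans; apply; rewrite le_eqVlt; apply/orP; left; apply/eqP; ring.
Qed.

Lemma depth_unbounded : unbounded_on_ray eta -> forall N, exists j, (N <= depth j)%N.
Proof.
move=> unb N; have [t t1 lt] := unb (N%:R * H).
have t0 : 0 <= t by exact: le_trans t1.
have /andP[_ hi] := truncn_itv t0.
exists (Num.truncn t).+1; rewrite truncn_ge_nat; last first.
  by rewrite divr_ge0 ?(ltW H_gt0) // (le_trans _ (eta_ge1 (nat_ge1 _))).
rewrite ler_pdivlMr //; apply: le_trans (ltW lt) _.
exact: eta_increasing t1 (ltW hi).
Qed.

End Eta.

(** * Even levels and the rearrangement *)

Lemma exists_even_levels (M b : nat -> nat) : exists P : pred nat,
  forall n, P n = if nonroot M n then ~~ P (par b n) else true.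
Proof.
pose fix ev k n {struct k} := if k is k'.+1 then
  (if nonroot M n then ~~ ev k' (par b n) else true) else true.
have ev0 k n : nonroot M n = false -> ev k n = true.
  by case: k => //= k ->.
have evE k n : (n <= k)%N -> ev k n = ev n n.
  elim: n {-2}n (leqnn n) k => [|N IH] n nN k nk.
    have root : nonroot M n = false.
      by apply/negP => /(par_ltn b); rewrite ltnNge (leq_trans nN).
    by rewrite !ev0.
  have [nr|/negbTE root] := boolP (nonroot M n); last first.
    by rewrite !ev0.
  have lt := par_ltn b nr; case: k nk => [|k] nk; first by move: lt; rewrite ltnNge (leq_trans nk).
  case: n nN nk nr lt => // n nN nk nr lt.
  by rewrite /= nr (IH (par b n.+1)) ?(IH (par b n.+1) _ n) //; lia.
exists (fun n => ev n n) => n; have [nr|/negbTE root] := boolP (nonroot M n).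
  have lt := par_ltn b nr; case: n nr lt => // n nr lt.
  by rewrite /= nr evE.
by case: n root => //= n ->.
Qed.

(* Within each block [base j, base j.+1) list first the points outside P. *)
Section Rearrangement.
Variable P : pred nat.

Let block j := index_iota (base j) (base j.+1).
Let L j := [seq n <- block j | ~~ P n] ++ [seq n <- block j | P n].

Definition odd_count j := size [seq n <- block j | ~~ P n].

Let memL n j : (n \in L j) = (blk n == j).
Proof.
rewrite mem_cat !mem_filter -andb_orl orNb mem_index_iota ltn_blk_base ltnS andTb.
by rewrite [(base j <= n)%N]leqNgt ltn_blk_base -leqNgt eqn_leq andbC.
Qed.

Let uniqL j : uniq (L j).
Proof.
rewrite cat_uniq !filter_uniq ?iota_uniq // andbT.
by apply/hasPn => n; rewrite !mem_filter => /andP[-> _].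
Qed.

Let sizeL j : size (L j) = (3 * 4 ^ j)%N.
Proof.
rewrite size_cat !size_filter addnC count_predC size_iota base_next; lia.
Qed.

Let off_lt n : (off n < 3 * 4 ^ blk n)%N.
Proof. by have := ltn_base_blk n; rewrite base_next -{1}(base_off n) ltn_add2l. Qed.

Definition rearrange n := nth 0%N (L (blk n)) (off n).
Definition unrearrange n := (base (blk n) + index n (L (blk n)))%N.

Let index_lt n : (index n (L (blk n)) < 3 * 4 ^ blk n)%N.
Proof. by rewrite -sizeL index_mem memL. Qed.

Lemma rearrangeK : cancel rearrange unrearrange.
Proof.
move=> n; rewrite /unrearrange /rearrange.
have /eqP -> : blk (nth 0%N (L (blk n)) (off n)) == blk n.
  by rewrite -memL mem_nth // sizeL.
by rewrite index_uniq ?sizeL // base_off.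
Qed.

Lemma unrearrangeK : cancel unrearrange rearrange.
Proof.
move=> n; rewrite /unrearrange /rearrange blk_base_add // off_base_add //.
by rewrite nth_index // memL.
Qed.

Lemma rearrange_bij : bijective rearrange.
Proof. by exists unrearrange; [exact: rearrangeK | exact: unrearrangeK]. Qed.

(** The partial sum of this length exhausts the earlier blocks and leaves, of block j, exactly the
    points of P. *)
Lemma unrearrange_lt n j : (unrearrange n < base j + odd_count j)%N =
  (blk n < j)%N || (blk n == j) && ~~ P n.
Proof.
have blkE : blk (unrearrange n) = blk n by rewrite blk_base_add.
have oc : (odd_count j <= 3 * 4 ^ j)%N by rewrite -sizeL size_cat leq_addr.
case: (ltngtP (blk n) j) => [lt|gt|E] /=.
- apply: leq_trans (leq_addr _ _); rewrite ltn_blk_base blkE //.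
- apply/negbTE; rewrite -leqNgt.
  apply: leq_trans (_ : base j.+1 <= _)%N; first by rewrite base_next leq_add2l.
  by rewrite leqNgt ltn_blk_base blkE -leqNgt.
- rewrite /unrearrange E ltn_add2l /L index_cat /odd_count.
  have inb : n \in block j.
    by have := memL n j; rewrite E eqxx mem_cat !mem_filter -andb_orl orNb.
  rewrite mem_filter inb andbT; case Pn: (P n) => /=.
    by rewrite ltnNge leq_addr.
  by rewrite index_mem mem_filter inb andbT Pn.
Qed.

End Rearrangement.

(** * Conditionality *)

Section RootSupported.
Variables (R : realType) (F : scalar_field R) (p : R).
Hypotheses (hF : good_scalars F) (p_gt0 : 0 < p) (p_le1 : p <= 1).
Variables b d : nat -> nat.
Hypothesis b_gt1 : forall j, (1 < b j)%N.
Let M j := tree_size (b j) (d j).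
Hypothesis M_le : forall j, (M j <= 4 ^ j)%N.
Variable P : pred nat.
Hypothesis P_even : forall n, P n = if nonroot M n then ~~ P (par b n) else true.
Variable f : sequences F.
Hypothesis f_roots : forall n, nonroot M n -> f n = 0.

Lemma bsum_wcoef j : bsum M (wcoef p M b f) j = (d j).+1%:R * pw p f (base j).
Proof.
rewrite /bsum sum_tree_size; first last.
- move=> i /andP[i0 iM].
  have nr : nonroot M (base j + i) by rewrite (nonroot_base_add M_le).
  have := wcoef_par hF p_gt0 b f nr; rewrite (par_base_add b M_le iM) => E.
  rewrite /wcoef (coef_step p_gt0 p_le1) f_roots // add0r (par_base_add b M_le iM) E.
  by rewrite blk_base_add //; exact: (ltn_M_gap M_le).
- exact: ltnW.
rewrite addn0 (wcoef_root p_gt0 p_le1) //.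
by rewrite -[base j]addn0 (nonroot_base_add M_le) // tree_size_gt0.
Qed.

(* Each edge joins an even to an odd level, so exactly one of its ends
   contributes to the projection. *)
Lemma pw_proj_even (Q : pred nat) n : Q n = P n -> Q (par b n) = P (par b n) ->
  pw p (tree_proj p M b Q f) n = wcoef p M b f n.
Proof.
move=> Qn Qp; rewrite /pw /tree_proj Qn Qp P_even; have [nr|root] := boolP (nonroot M n).
  have E : coef p M b n f = edge F p M b n * coef p M b (par b n) f.
    by rewrite (coef_step p_gt0 p_le1) f_roots // add0r.
  rewrite /wcoef E; case: (P (par b n)) => /=; last by rewrite mulr0 subr0 -E.
  by rewrite sub0r (mpowN p hF).
by rewrite edge_root // mul0r subr0.
Qed.

(** Agreement of Q with P on a single tree is enough, so Q may be a finite set of even nodes or the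
    complement of the indices of a partial sum. *)
Lemma bsum_proj_even (Q : pred nat) j :
  (forall n, blk n = j -> off n < M j -> Q n = P n)%N ->
  bsum M (pw p (tree_proj p M b Q f)) j = (d j).+1%:R * pw p f (base j).
Proof.
move=> QP; rewrite -bsum_wcoef; apply: eq_big_nat => i /andP[_ iM].
have gap := ltn_M_gap M_le iM.
have QPi k : (k < M j)%N -> Q (base j + k)%N = P (base j + k)%N.
  move=> kM; have gapk := ltn_M_gap M_le kM.
  by apply: QP; rewrite ?blk_base_add ?off_base_add.
apply: pw_proj_even; first exact: QPi.
rewrite (par_base_add b M_le iM); apply: QPi.
by apply: leq_ltn_trans iM; rewrite (leq_trans (leq_div _ _)) // leq_pred.
Qed.

End RootSupported.

Section EtaBasis.
Variables (R : realType) (F : scalar_field R) (p : R).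
Hypotheses (hF : good_scalars F) (p_gt0 : 0 < p) (p_le1 : p <= 1).
Variable eta : R -> R.
Hypothesis eta_ge1 : forall t, 1 <= t -> 1 <= eta t.
Hypothesis eta_concave : concave_on_ray eta.
Hypothesis eta_increasing : forall s t, 1 <= s -> s <= t -> eta s <= eta t.

Let X : qspace F := convexified_tsirelson F p.
Let M := node_count eta.
Let b := arity eta.
Let M_gt0 : forall j, (0 < M j)%N := node_count_gt0 eta.
Let M_le : forall j, (M j <= 4 ^ j)%N := node_count_le eta_ge1 eta_concave eta_increasing.
Let b_gt1 : forall j, (1 < b j)%N := arity_gt1 eta.
Let H := eta 2.

Local Notation x := (tree_vec F p M b).
Local Notation xs := (coef p M b).
Local Notation tree_proj := (tree_proj p M b).
Local Notation pw := (pw p).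

Let H_ge1 : 1 <= H. Proof. by apply: eta_ge1; rewrite ler1n. Qed.

Lemma conditionality_upper m : (1 < m)%N ->
  (conditionality_constant (X := X) x xs m <=
   (150 `^ p^-1 * eta (log2 m%:R) `^ p^-1)%:E)%E.
Proof.
move=> m1; have [lo _] := log2_bounds R (ltnW m1).
have t0 : (0 < trunc_log 2 m)%N by rewrite trunc_log_gt0.
have et : 1 <= eta (log2 m%:R) by apply: eta_ge1; apply: le_trans lo; rewrite ler1n.
have et0 : 0 <= eta (log2 m%:R) by exact: le_trans et.
apply: ge_ereal_sup => _ [A /= cA <-].
apply: ge_ereal_sup => _ [f [hf f1] <-].
rewrite lee_fin -(powRM _ (ler0n R 150) et0).
apply: (qnorm_le hF p_gt0).
  rewrite coord_projectionE; exact: (points_proj hF p_gt0 p_le1 b M_le).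
rewrite coord_projectionE.
have hf1 : tle (pw f) 1.
  apply: tle_weaken (tle_qnorm hF p_gt0 hf).
  have q0 := qnorm_ge0 hF hf.
  have := @ge0_ler_powR _ p (ltW p_gt0) (qnorm f) 1.
  by rewrite powR1 !nnegrE; apply.
have -> : 150 * eta (log2 m%:R) = 30 * (5 * eta (log2 m%:R)) * 1 by ring.
apply: (tle_proj_top hF p_gt0 p_le1 M_gt0 M_le b_gt1) hf1 => [|j]; first by lra.
have [r [lr rle]] := levels_needed eta_ge1 eta_concave eta_increasing j m1.
exists r => //; apply: leq_trans lr; rewrite leq_min; apply/andP; split.
  apply: leq_trans cA; have inj : injective (fun i => (base j + i)%N) by move=> i i' /addnI.
  rewrite -(count_map (fun i => (base j + i)%N) (fun n => n \in A)) -size_filter.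
  apply: uniq_leq_size; first by rewrite filter_uniq // map_inj_uniq // iota_uniq.
  by move=> n; rewrite mem_filter => /andP[].
by apply: leq_trans (count_size _ _) _; rewrite size_iota.
Qed.

Lemma conditionality_lower m : (1 < m)%N ->
  (((12 * H ^+ 2)^-1 `^ p^-1 * eta (log2 m%:R) `^ p^-1)%:E <=
   conditionality_constant (X := X) x xs m)%E.
Proof.
move=> m1; have [lo _] := log2_bounds R (ltnW m1).
have t0 : (0 < trunc_log 2 m)%N by rewrite trunc_log_gt0.
have et : 1 <= eta (log2 m%:R) by apply: eta_ge1; apply: le_trans lo; rewrite ler1n.
have et0 : 0 <= eta (log2 m%:R) by exact: le_trans et.
have H0 : 0 < 12 * H ^+ 2 by rewrite mulr_gt0 ?ltr0n // exprn_gt0 // (lt_le_trans _ H_ge1).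
have Hi : 0 <= (12 * H ^+ 2)^-1 by rewrite invr_ge0 ltW.
(* The tree of this block has fewer than 2^(j+1) <= m nodes, so all its even nodes may be kept. *)
pose j := (trunc_log 2 m).-1.
have [P P_even] := exists_even_levels M b.
pose A := [fset n in [seq (base j + i)%N | i <- iota 0 (M j)] | P n]%fset.
have inA n : blk n = j -> (off n < M j)%N -> (n \in A) = P n.
  move=> bn on; rewrite !inE /=; case: (P n); rewrite ?andbT ?andbF //.
  apply/mapP; exists (off n); first by rewrite mem_iota.
  by rewrite -bn base_off.
have cA : (#|` A| <= m)%N.
  apply: leq_trans (_ : size [seq (base j + i)%N | i <- iota 0 (M j)] <= _)%N.
    apply: uniq_leq_size; first exact: fset_uniq.
    by move=> n; rewrite !inE /= => /andP[].
  rewrite size_map size_iota.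
  have := node_count_lt eta_ge1 eta_concave eta_increasing j.
  rewrite /j prednK // => /ltnW /leq_trans; apply.
  exact: trunc_logP (ltnW m1).
pose f := unit_vec F (base j).
have hf : points X f.
  apply: (points_finite hF p_gt0 (K := (base j).+1)) => n lt.
  by rewrite /f /unit_vec gtn_eqF.
have f1 : qnorm (f : ambient X) <= 1.
  by have := qnorm_le hF p_gt0 hf (tle_unit_vec hF p_gt0 (base j)); rewrite powR1.
have f_roots n : nonroot M n -> f n = 0.
  move=> nr; rewrite /f /unit_vec (_ : n == base j = false) //; apply/eqP => nj.
  by move: nr; rewrite nj -[base j]addn0 (nonroot_base_add M_le).
set q := qnorm (coord_projection (X := X) x xs A f : ambient X).
apply: (@le_trans _ _ q%:E); last first.
  apply: le_trans (ereal_sup_ubound _); last by exists A.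
  by apply: ereal_sup_ubound; exists f.
have pA : points X (tree_proj (fun n => n \in A) f).
  exact: (points_proj hF p_gt0 p_le1 b M_le).
have bs := bsum_le M_le j (pw_ge0 p _) (tle_qnorm hF p_gt0 pA).
rewrite (bsum_proj_even hF p_gt0 p_le1 b_gt1 M_le P_even f_roots inA) in bs.
rewrite (pw_unit_vec hF p_gt0) eqxx mulr1 -ler_pdivrMl // in bs.
have le := eta_log_le_depth eta_ge1 eta_concave eta_increasing m1.
rewrite -/H -/j -ler_pdivrMl // in le.
rewrite lee_fin -(powRM _ Hi et0) /q coord_projectionE.
rewrite -[leRHS](powRKV p_gt0 (qnorm_ge0 hF pA)).
apply: (ler_powRV p_gt0); first by rewrite mulr_ge0.
by apply: le_trans le _; rewrite mulrC.
Qed.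

Lemma conditionality_equivalent :
  equivalent_from 2 (conditionality_constant (X := X) x xs)
    (fun m => eta (log2 m%:R) `^ p^-1).
Proof.
exists ((12 * H ^+ 2)^-1 `^ p^-1), (150 `^ p^-1).
have H2 : 1 <= 12 * H ^+ 2.
  have : 1 <= H ^+ 2 by rewrite exprn_ege1.
  by lra.
have H0 : 0 < 12 * H ^+ 2 by exact: lt_le_trans H2.
split=> [||m m2].
- by apply: powR_gt0; rewrite invr_gt0.
- apply: (ler_powRV p_gt0); first by rewrite invr_ge0 ltW.
  by apply: (@le_trans _ _ 1); [rewrite invf_le1 | rewrite ler1n].
- by split; [exact: conditionality_lower | exact: conditionality_upper].
Qed.

(** * A vector whose rearranged expansion diverges *)

Section Conditional.
Hypothesis eta_unbounded : unbounded_on_ray eta.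
Let d := depth eta.
Let il j := trunc_log 2 (d j).+1.
Let wt (k : nat) : R := (2 ^ il k)%N%:R^-1.
(* The weights telescope, and each time the logarithm of the depth jumps, the
   weight is at least the reciprocal of the depth. *)
Let lam j := if j is k.+1 then wt k - wt k.+1 else 0.

Let il_mono : {homo il : i j / (i <= j)%N}.
Proof.
move=> i j ij; apply: leq_trunc_log; rewrite ltnS.
exact: (leq_depth eta_ge1 eta_increasing).
Qed.

Let wt_gt0 k : 0 < wt k.
Proof. by rewrite invr_gt0 ltr0n expn_gt0. Qed.

Let lam_ge0 j : 0 <= lam j.
Proof.
case: j => //= k; rewrite subr_ge0 lef_pV2 ?posrE ?ltr0n ?expn_gt0 //.
by rewrite ler_nat leq_exp2l // il_mono.
Qed.

Let lam_jump k : (il k < il k.+1)%N -> 1 <= (d k.+1).+1%:R * lam k.+1.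
Proof.
move=> jump; have le1 : 2 * wt k.+1 <= wt k.
  rewrite /wt ler_pdivrMr ?ltr0n ?expn_gt0 // mulrC ler_pdivlMr ?ltr0n ?expn_gt0 //.
  by rewrite -natrM ler_nat -expnS leq_exp2l.
have : (2 ^ il k.+1)%N%:R <= (d k.+1).+1%:R :> R.
  by rewrite ler_nat; exact: trunc_logP.
have : (2 ^ il k.+1)%N%:R * wt k.+1 = 1 :> R.
  by rewrite divff // pnatr_eq0 -lt0n expn_gt0.
move=> E le2; rewrite -[leLHS]E (_ : lam k.+1 = wt k - wt k.+1) //.
apply: (@le_trans _ _ ((d k.+1).+1%:R * wt k.+1)).
  by rewrite ler_wpM2r // ltW.
by rewrite ler_wpM2l //; lra.
Qed.

Let exists_jump K : exists2 k, (K <= k)%N & (il k < il k.+1)%N.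
Proof.
have ub : exists j, (il K < il j)%N.
  have [j dj] := depth_unbounded eta_ge1 eta_increasing eta_unbounded (2 ^ (il K).+1).
  exists j; apply: leq_trans (_ : trunc_log 2 (2 ^ (il K).+1) <= _)%N.
    by rewrite trunc_expnK.
  by apply: leq_trunc_log; rewrite leqW.
have [j lt minj] := ex_minnP ub.
case: j lt minj => [|k] lt minj.
  by have := il_mono (leq0n K); rewrite leqNgt lt.
have Kk : (K <= k)%N.
  by rewrite -ltnS ltnNge; apply/negP => /il_mono; rewrite leqNgt lt.
exists k => //; apply: leq_ltn_trans lt; rewrite leqNgt; apply/negP => /minj.
by rewrite ltnn.
Qed.

Let f : sequences F :=
  fun n => if n == base (blk n) then of_real F (lam (blk n) `^ p^-1) else 0.

Let pw_f : pw f = root_seq lam.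
Proof.
apply: funext => n; rewrite /pw /f /root_seq; case: ifP => _; last exact: mpow0.
by rewrite /mpow (modulus_real hF) ger0_norm ?powR_ge0 // powRVK.
Qed.

Let f_points : points X f.
Proof.
apply/(pointsP p hF) => e e0.
have [k wk] : exists k, wt k <= e.
  have [n] : exists n, (2 ^ n)%N%:R^-1 <= e.
    exists (Num.truncn e^-1).+1; rewrite invf_ple ?posrE ?ltr0n ?expn_gt0 //.
    have ei : 0 <= e^-1 by rewrite invr_ge0 ltW.
    have /andP[_ /ltW le] := truncn_itv ei; apply: le_trans le _.
    by rewrite ler_nat ltnW // ltn_expl.
  move=> le; have [j dj] := depth_unbounded eta_ge1 eta_increasing eta_unbounded (2 ^ n).
  exists j; apply: le_trans le; rewrite lef_pV2 ?posrE ?ltr0n ?expn_gt0 //.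
  rewrite ler_nat leq_exp2l //; apply: trunc_log_max => //.
  exact: leq_trans dj _.
exists (base k.+1).
pose lamt j := if (k < j)%N then lam j else 0.
have lamt_ge0 j : 0 <= lamt j by rewrite /lamt; case: ifP.
have -> : tailpart (base k.+1) (pw f) = root_seq lamt.
  apply: funext => n; rewrite pw_f /tailpart /root_seq /lamt.
  rewrite leqNgt ltn_blk_base -leqNgt; by case: (k < blk n)%N; case: (n == _).
have root_ge0 n : 0 <= root_seq lamt n.
  by rewrite /root_seq; case: ifP.
apply: tle_l1 => // N; apply: le_trans wk.
apply: (@le_trans _ _ (\sum_(0 <= n < base N) 1 * root_seq lamt n)).
  rewrite [leRHS](big_cat_nat (leq0n _) (leq_base_id N)) /=.
  under [X in _ <= X + _]eq_bigr do rewrite mul1r.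
  by rewrite lerDl sumr_ge0 // => n _; rewrite mul1r.
rewrite (sum_root_seq (fun=> 1)).
under eq_bigr do rewrite mul1r.
(* Telescoping, with the remaining weight kept on the left so that the inequality passes through the
   induction. *)
have : \sum_(0 <= j < N) lamt j + (if (k < N)%N then wt N.-1 else wt k) <= wt k.
  elim: N => [|N IH]; first by rewrite big_geq // add0r.
  rewrite big_nat_recr //=; move: IH; rewrite /lamt ltnS.
  case: (ltngtP k N) => [kN|kN|kN] /=.
  - case: N kN => // N kN /=; lra.
  - by rewrite addr0.
  - rewrite -kN; lra.
have : 0 < (if (k < N)%N then wt N.-1 else wt k) by case: ifP.
lra.
Qed.

(** One vector and one bijection have to fail. Partial sums that end after the odd levels of block j
    leave its even levels, with block sum (d_j + 1) lam_j, and [exists_jump] finds arbitrarily late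
    j for which this is at least 1. The bound 2^-1 on the p-th power comes from [bsum_le]. *)
Lemma tree_conditional : ~ unconditional_basis (X := X) x xs.
Proof.
move=> unc; have [P P_even] := exists_even_levels M b.
have f_roots n : nonroot M n -> f n = 0.
  move=> nr; rewrite /f ifF //; apply/eqP => nb.
  by move: nr; rewrite nb -[base _]addn0 (nonroot_base_add M_le).
have cvg := unc f f_points _ (rearrange_bij P).
have e0 : 0 < 2^-1 `^ p^-1 :> R by rewrite powR_gt0 // invr_gt0.
move/cvgrPdist_lt : cvg => /(_ _ e0) [N _ hN].
have [k Nk jump] := exists_jump N.
pose j := k.+1; pose n0 := (base j + odd_count P j)%N.
have Nn0 : (N <= n0)%N.
  apply: leq_trans (leq_addr _ _); apply: leq_trans (leq_base_id j).
  exact: leqW.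
have := hN n0 Nn0; rewrite /= sub0r normrN.
pose A := [fset rearrange P i | i in iota 0 n0]%fset.
have inA n : (n \in A) = (blk n < j)%N || (blk n == j) && ~~ P n.
  rewrite -unrearrange_lt; apply/imfsetP/idP => /= [[i lti ->]|lt].
    by move: lti; rewrite mem_iota rearrangeK.
  by exists (unrearrange P n); rewrite ?mem_iota ?unrearrangeK.
have -> : \sum_(i < n0) xs (rearrange P i) f *: x (rearrange P i) =
    coord_projection (X := X) x xs A f.
  rewrite /coord_projection (perm_big _ (perm_image_iota n0 (bij_inj (rearrange_bij P)))).
  by rewrite big_map -(big_mkord xpredT (fun i => xs (rearrange P i) f *: x (rearrange P i)))
    /index_iota subn0.
rewrite coord_projectionE.
have fE : f - tree_proj (fun n => n \in A) f = tree_proj (fun n => n \notin A) f.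
  by rewrite -{1}(proj_split p_gt0 p_le1 M b (fun n => n \in A) f) addrC addKr.
have pA : points X (f - tree_proj (fun n => n \in A) f).
  apply: (pointsB hF p_gt0 p_le1); first exact: f_points.
  exact: (points_proj hF p_gt0 p_le1 b M_le).
have bs := bsum_le M_le j (pw_ge0 p _) (tle_qnorm hF p_gt0 pA).
rewrite {1}fE (bsum_proj_even hF p_gt0 p_le1 b_gt1 M_le P_even f_roots) in bs; last first.
  by move=> n bn _; rewrite inA bn ltnn eqxx negbK.
have pwj : pw f (base j) = lam j by rewrite pw_f /root_seq blk_base eqxx.
rewrite pwj in bs; have q0 := qnorm_ge0 hF pA.
rewrite (ger0_norm q0) ltNge => /negP; apply.
rewrite -[leRHS](powRKV p_gt0 q0); apply: (ler_powRV p_gt0); first by rewrite invr_ge0.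
have := lam_jump jump; rewrite -/j => jl.
by have := le_trans jl bs; lra.
Qed.

End Conditional.

End EtaBasis.

Theorem theorem5p1 (R : realType) (F : scalar_field R)
    (hF : F = real_scalars R \/ F = complex_scalars R)
    (p : R) (hp0 : 0 < p) (hp1 : p <= 1)
    (eta : R -> R)
    (eta_ge1 : forall t, 1 <= t -> 1 <= eta t)
    (eta_concave : concave_on_ray eta)
    (eta_increasing : forall s t, 1 <= s -> s <= t -> eta s <= eta t) :
  exists (x : nat -> ambient (convexified_tsirelson F p))
         (xs : nat -> ambient (convexified_tsirelson F p) -> F),
    [/\ is_basis x xs,
        unbounded_on_ray eta -> ~ unconditional_basis x xs,
        almost_greedy_basis x xs,
        equivalent_from 2 (conditionality_constant x xs)
          (fun m => eta (log2 m%:R) `^ p^-1) &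
        equivalent_from 1 (fundamental_function x)
          (fun m => m%:R `^ p^-1)].
Proof.
have gF : good_scalars F.
  by case: hF => ->; [exact: good_real_scalars | exact: good_complex_scalars].
have M_gt0 := node_count_gt0 eta.
have M_le := node_count_le eta_ge1 eta_concave eta_increasing.
have b_gt1 := arity_gt1 eta.
exists (tree_vec F p (node_count eta) (arity eta)), (coef p (node_count eta) (arity eta)).
split.
- exact: (tree_basis gF hp0 hp1 M_gt0 M_le b_gt1).
- exact: (tree_conditional gF hp0 hp1 eta_ge1 eta_concave eta_increasing).
- exact: (tree_almost_greedy gF hp0 hp1 M_gt0 M_le b_gt1).
- exact: (conditionality_equivalent gF hp0 hp1 eta_ge1 eta_concave eta_increasing).
- exact: (tree_fundamental_function gF hp0 hp1 M_gt0 M_le b_gt1).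
Qed.
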